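(* Let $T$ be an operator in $B_1(\mathbb D)$. Assume that $T^*$ is a $2$ hyper-contraction and that polynomials are dense in $\mathcal H_{\phi(T)}(0)$ for every automorphism $\phi$ of the unit disc $\mathbb D$. If $\mathcal K_T(\zeta)=-(1-|\zeta|^2)^{-2}$ for an arbitrary but fixed point $\zeta\in\mathbb D$, then $T$ is unitarily equivalent to $U_+^*$, the backward shift operator.
   Context: $\mathbb D$ is the open unit disc. A bounded operator $T$ on a complex separable Hilbert space $\mathcal H$ is in $B_1(\mathbb D)$ if $\dim\ker(T-wI)=1$ and $T-wI$ has closed range for each $w\in\mathbb D$, and the closed linear span of $\bigcup_{w\in\mathbb D}\ker(T-wI)$ is $\mathcal H$. The curvature of $T$ is $\mathcal K_T(w)=-\frac{\partial^2}{\partial w\,\partial\bar w}\log\|\gamma(w)\|^2$, where $\gamma$ is any local non-vanishing holomorphic map with $\gamma(w)\in\ker(T-wI)$. A bounded operator $A$ is a $2$ hyper-contraction if $I-A^*A\ge0$ and ${A^*}^2A^2-2A^*A+I\ge0$. In particular $T$ here is a contraction, and for every automorphism $\phi$ of $\mathbb D$ the operator $\phi(T)$ is again a contraction in $B_1(\mathbb D)$. $\mathcal H_{\phi(T)}(0)$: every operator $P\in B_1(\mathbb D)$ is unitarily equivalent to the adjoint $M^*$ of multiplication by the coordinate function on a reproducing kernel Hilbert space $\mathcal H_K$ of holomorphic functions on $\mathbb D$, with kernel $K$ and $K(\cdot,w)\ne0$ for all $w$. On a neighborhood $U$ of $0$ on which $K(\cdot,0)$ does not vanish, the kernel normalized at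 $0$ is $K^P_{(0)}(z,w)=K(0,0)K(z,0)^{-1}K(z,w)\overline{K(w,0)}^{-1}$, which satisfies $K^P_{(0)}(z,0)=1$; near $0$ it does not depend on the chosen realization (Curto–Salinas). $\mathcal H_P(0)$ is the reproducing kernel Hilbert space of holomorphic functions with kernel $K^P_{(0)}$, i.e. $\{K(\cdot,0)^{-1}K(0,0)^{1/2}f: f\in\mathcal H_K\}$, and $P$ is unitarily equivalent to $M^*$ on $\mathcal H_P(0)$; it contains the constants, hence all polynomials. $\mathcal H_{\phi(T)}(0)$ is this space for $P=\phi(T)$. $U_+$ is the forward unilateral shift on $\ell^2(\mathbb N)$ and $U_+^*$ is its adjoint. *)

(* Defs.v *)
From Stdlib Require Import Reals Lra Lia ClassicalEpsilon.
From Stdlib Require Import FunctionalExtensionality PropExtensionality ProofIrrelevance.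
From Coquelicot Require Import Coquelicot.
Open Scope R_scope.

(** The inner product is linear in its first argument.  [inner_norm] ties it to
    the norm of the underlying Banach space, so positivity and definiteness
    come from the norm axioms. *)
Record HilbertSpace := {
  hilbert_carrier :> CompleteNormedModule C_AbsRing;
  inner : hilbert_carrier -> hilbert_carrier -> C;
  inner_plus_l : forall x y z, inner (plus x y) z = Cplus (inner x z) (inner y z);
  inner_scal_l : forall (c : C) x y, inner (scal c x) y = Cmult c (inner x y);
  inner_conj : forall x y, inner y x = Cconj (inner x y);
  inner_norm : forall x, inner x x = RtoC (norm x ^ 2)
}.
Arguments inner {h} _ _.

Definition dense {H : HilbertSpace} (S : H -> Prop) : Prop :=
  forall (x : H) (eps : posreal), exists y : H, S y /\ norm (minus x y) < eps.

Definition separable (H : HilbertSpace) : Prop :=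
  exists d : nat -> H, dense (fun x => exists n, x = d n).

Inductive linear_span {H : HilbertSpace} (S : H -> Prop) : H -> Prop :=
| span_zero : linear_span S zero
| span_add : forall (c : C) (x y : H),
    S x -> linear_span S y -> linear_span S (plus (scal c x) y).

Definition one_dimensional {H : HilbertSpace} (V : H -> Prop) : Prop :=
  exists e : H, e <> zero /\ forall x : H, V x <-> exists c : C, x = scal c e.

(** For a bounded [A] there is exactly one such [As], namely [A^*]. *)
Definition is_adjoint {H1 H2 : HilbertSpace} (A : H1 -> H2) (As : H2 -> H1) : Prop :=
  forall (x : H1) (y : H2), inner (A x) y = inner x (As y).

(** [is_linear] is Coquelicot's predicate for bounded linear maps. *)
Definition is_unitary {H1 H2 : HilbertSpace} (V : H1 -> H2) : Prop :=
  is_linear V /\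
  (forall x y, inner (V x) (V y) = inner x y) /\
  (forall y, exists x, V x = y).

Definition unitarily_equivalent {H1 H2 : HilbertSpace}
    (A : H1 -> H1) (B : H2 -> H2) : Prop :=
  exists V : H1 -> H2, is_unitary V /\ forall x, V (A x) = B (V x).

Definition positive_operator {H : HilbertSpace} (A : H -> H) : Prop :=
  forall x, Im (inner (A x) x) = 0 /\ 0 <= Re (inner (A x) x).

(** [I - A^* A >= 0] and [A^*^2 A^2 - 2 A^* A + I >= 0], where [As] is [A^*]. *)
Definition two_hyper_contraction {H : HilbertSpace} (A As : H -> H) : Prop :=
  is_linear A /\ is_adjoint A As /\
  positive_operator (fun x => minus x (As (A x))) /\
  positive_operator (fun x =>
    plus (minus (As (As (A (A x)))) (scal (RtoC 2) (As (A x)))) x).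

Definition unit_disc (z : C) : Prop := Cmod z < 1.

Definition eigenspace {H : HilbertSpace} (T : H -> H) (w : C) (x : H) : Prop :=
  T x = scal w x.

Record cowen_douglas_B1 {H : HilbertSpace} (T : H -> H) : Prop := {
  B1_bounded : is_linear T;
  B1_kernel : forall w, unit_disc w -> one_dimensional (eigenspace T w);
  B1_closed_range : forall w, unit_disc w ->
    closed (fun y : H => exists x : H, y = minus (T x) (scal w x));
  B1_span : dense (linear_span (fun x => exists w, unit_disc w /\ eigenspace T w x))
}.

Definition holomorphic_at {V : NormedModule C_AbsRing} (f : C -> V) (z : C) : Prop :=
  @ex_derive C_AbsRing V f z.

(** Wirtinger derivatives [d_w = (d_x - i d_y)/2] and [d_wbar = (d_x + i d_y)/2].
    [Derive] is total; it is only meaningful where the function is smooth. *)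
Definition d_x (f : C -> C) (z : C) : C :=
  (Derive (fun t : R => Re (f (Cplus z (RtoC t)))) 0,
   Derive (fun t : R => Im (f (Cplus z (RtoC t)))) 0).

Definition d_y (f : C -> C) (z : C) : C :=
  (Derive (fun t : R => Re (f (Cplus z (Cmult Ci (RtoC t))))) 0,
   Derive (fun t : R => Im (f (Cplus z (Cmult Ci (RtoC t))))) 0).

Definition d_w (f : C -> C) (z : C) : C :=
  Cdiv (Cminus (d_x f z) (Cmult Ci (d_y f z))) (RtoC 2).

Definition d_wbar (f : C -> C) (z : C) : C :=
  Cdiv (Cplus (d_x f z) (Cmult Ci (d_y f z))) (RtoC 2).

Definition local_frame {H : HilbertSpace} (T : H -> H) (w : C) (gamma : C -> H) : Prop :=
  locally w (fun v =>
    holomorphic_at gamma v /\ gamma v <> zero /\ eigenspace T v (gamma v)).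

(** [K_T(w) = k].  For [T] in the Cowen-Douglas class local frames exist at every
    [w] in the disc and all of them give the same value. *)
Definition has_curvature {H : HilbertSpace} (T : H -> H) (w : C) (k : C) : Prop :=
  (exists gamma, local_frame T w gamma) /\
  forall gamma, local_frame T w gamma ->
    Copp (d_w (d_wbar (fun v => RtoC (ln (norm (gamma v) ^ 2)))) w) = k.

Definition disc_automorphism (phi : C -> C) : Prop :=
  exists psi : C -> C,
    (forall z, unit_disc z ->
       unit_disc (phi z) /\ unit_disc (psi z) /\
       psi (phi z) = z /\ phi (psi z) = z /\
       @holomorphic_at C_NormedModule phi z /\
       @holomorphic_at C_NormedModule psi z).

(** [P = phi(T)]: the Taylor series of [phi] at [0], evaluated at [T], converges to
    [P] in operator norm.  The Taylor series of an automorphism of the disc has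
    radius of convergence larger than 1, so for a contraction [T] this is the
    Riesz functional calculus. *)
Definition is_functional_calculus {H : HilbertSpace}
    (phi : C -> C) (T P : H -> H) : Prop :=
  is_linear P /\
  exists a : nat -> C,
    (forall z, unit_disc z ->
       @is_pseries C_AbsRing C_NormedModule a z (phi z)) /\
    (forall eps : posreal, exists N : nat, forall n, (N <= n)%nat -> forall x : H,
       norm (minus (P x) (sum_n (fun k => scal (a k) (Nat.iter k T x)) n))
         <= eps * norm x).

(** A Hilbert space of holomorphic functions on [U]: a vector [f] stands for the
    restriction of [rk_eval f] to [U], and [rk_vector w] stands for [K(., w)].
    Values outside [U] are irrelevant. *)
Record RKHS (U : C -> Prop) := {
  rk_space :> HilbertSpace;
  rk_eval : rk_space -> C -> C;
  rk_eval_plus : forall f g z, U z ->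
    rk_eval (plus f g) z = Cplus (rk_eval f z) (rk_eval g z);
  rk_eval_scal : forall (c : C) f z, U z ->
    rk_eval (scal c f) z = Cmult c (rk_eval f z);
  rk_eval_inj : forall f, (forall z, U z -> rk_eval f z = RtoC 0) -> f = zero;
  rk_holomorphic : forall f z, U z -> @holomorphic_at C_NormedModule (rk_eval f) z;
  rk_vector : C -> rk_space;
  rk_reproducing : forall f w, U w -> rk_eval f w = inner f (rk_vector w)
}.
Arguments rk_eval {U} _ _ _.
Arguments rk_vector {U} _ _.

Definition rk_kernel {U : C -> Prop} (F : RKHS U) (z w : C) : C :=
  rk_eval F (rk_vector F w) z.

Definition is_multiplication_by_z {U : C -> Prop} (F : RKHS U) (M : F -> F) : Prop :=
  forall f z, U z -> rk_eval F (M f) z = Cmult z (rk_eval F f z).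

Definition realizes {H : HilbertSpace} (P : H -> H) (F : RKHS unit_disc) : Prop :=
  (forall w, unit_disc w -> rk_vector F w <> zero) /\
  exists M Ms : F -> F,
    is_linear M /\ is_multiplication_by_z F M /\ is_adjoint M Ms /\
    unitarily_equivalent P Ms.

Definition kernel_normalized_at_0 {U : C -> Prop} (F : RKHS U) (z w : C) : C :=
  let K := rk_kernel F in
  Cmult (Cmult (Cmult (K 0 0) (Cinv (K z 0))) (K z w)) (Cinv (Cconj (K w 0))).

(** [G] is the space [H_P(0)], seen as functions on the neighborhood [U] of [0]; a
    reproducing kernel Hilbert space on [U] is determined by its kernel. *)
Definition is_H0 {H : HilbertSpace} (P : H -> H) (U : C -> Prop) (G : RKHS U) : Prop :=
  open U /\ U (RtoC 0) /\ (forall z, U z -> unit_disc z) /\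
  exists F : RKHS unit_disc,
    realizes P F /\
    (forall z, U z -> rk_kernel F z (RtoC 0) <> RtoC 0) /\
    (forall z w, U z -> U w -> rk_kernel G z w = kernel_normalized_at_0 F z w).

Definition is_polynomial {U : C -> Prop} (G : RKHS U) (p : G) : Prop :=
  exists (n : nat) (a : nat -> C),
    forall z, U z -> rk_eval G p z = sum_n (fun k => Cmult (a k) (Cpow z k)) n.

Definition polynomials_dense {U : C -> Prop} (G : RKHS U) : Prop :=
  dense (is_polynomial G).

Record l2 := mk_l2 {
  l2_seq :> nat -> C;
  l2_summable : ex_series (fun n => Cmod (l2_seq n) ^ 2)
}.

Lemma l2_ext (a b : l2) : (forall n, a n = b n) -> a = b.
Proof.
destruct a as [a Ha], b as [b Hb]; simpl; intros E.
assert (a = b) by (apply functional_extensionality; exact E); subst b.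
f_equal; apply proof_irrelevance.
Qed.

Lemma ex_series_le_nonneg (a b : nat -> R) :
  (forall n, 0 <= a n <= b n) -> ex_series b -> ex_series a.
Proof.
intros H Hb; apply (ex_series_le (V := R_CompleteNormedModule) a b); [|exact Hb].
intro n; change (norm (a n)) with (Rabs (a n)); rewrite Rabs_pos_eq; apply H.
Qed.

Lemma ex_series_bounded (a : nat -> R) (M : R) :
  (forall n, 0 <= a n) -> (forall n, sum_n a n <= M) -> ex_series a.
Proof.
intros Ha HM.
destruct (ex_finite_lim_seq_incr (sum_n a) M) as [l Hl].
- intro n; rewrite sum_Sn; unfold plus; simpl; specialize (Ha (S n)); lra.
- exact HM.
- exists l; exact Hl.
Qed.

Lemma Series_bounded (a : nat -> R) (M : R) :
  (forall n, 0 <= a n) -> (forall n, sum_n a n <= M) -> Series a <= M.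
Proof.
intros Ha HM; pose proof (ex_series_bounded a M Ha HM) as E.
apply Series_correct in E.
apply (is_lim_seq_le (sum_n a) (fun _ => M) (Series a) M HM E).
apply is_lim_seq_const.
Qed.

Lemma sum_n_nonneg (a : nat -> R) n : (forall k, 0 <= a k) -> 0 <= sum_n a n.
Proof.
intros Ha; induction n as [|n IH].
- rewrite sum_O; apply Ha.
- rewrite sum_Sn; unfold plus; simpl; specialize (Ha (S n)); lra.
Qed.

Lemma sum_n_le_Series (a : nat -> R) n :
  (forall k, 0 <= a k) -> ex_series a -> sum_n a n <= Series a.
Proof.
intros Ha E; apply Series_correct in E.
apply (is_lim_seq_incr_compare (sum_n a) (Series a) E).
intro k; rewrite sum_Sn; unfold plus; simpl; specialize (Ha (S k)); lra.
Qed.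

Lemma Series_nonneg (a : nat -> R) : (forall k, 0 <= a k) -> ex_series a -> 0 <= Series a.
Proof.
intros Ha E; apply Rle_trans with (sum_n a 0).
- apply sum_n_nonneg, Ha.
- apply sum_n_le_Series; assumption.
Qed.

Lemma Cmod2_plus_le (x y : C) : Cmod (Cplus x y) ^ 2 <= 2 * Cmod x ^ 2 + 2 * Cmod y ^ 2.
Proof.
rewrite !Cmod2_alt; destruct x as [a b], y as [c d]; simpl.
pose proof (pow2_ge_0 (a - c)); pose proof (pow2_ge_0 (b - d)); nra.
Qed.

Lemma Cmod2_nonneg (x : C) : 0 <= Cmod x ^ 2.
Proof. apply pow2_ge_0. Qed.

Lemma l2_plus_summable (a b : l2) : ex_series (fun n => Cmod (Cplus (a n) (b n)) ^ 2).
Proof.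
apply ex_series_le_nonneg with (fun n => 2 * Cmod (a n) ^ 2 + 2 * Cmod (b n) ^ 2).
- intro n; split; [apply Cmod2_nonneg | apply Cmod2_plus_le].
- apply (ex_series_plus (V := R_NormedModule)).
  + apply (ex_series_scal_l 2 (fun n => Cmod (a n) ^ 2)), l2_summable.
  + apply (ex_series_scal_l 2 (fun n => Cmod (b n) ^ 2)), l2_summable.
Qed.

Lemma l2_scal_summable (c : C) (a : l2) : ex_series (fun n => Cmod (Cmult c (a n)) ^ 2).
Proof.
apply ex_series_ext with (fun n => Cmod c ^ 2 * Cmod (a n) ^ 2).
- intro n; rewrite Cmod_mult, Rpow_mult_distr; reflexivity.
- apply (ex_series_scal_l (Cmod c ^ 2) (fun n => Cmod (a n) ^ 2)), l2_summable.
Qed.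

Lemma l2_zero_summable : ex_series (fun _ : nat => Cmod (RtoC 0) ^ 2).
Proof.
apply ex_series_bounded with 0.
- intro; apply Cmod2_nonneg.
- intro n; rewrite sum_n_const, Cmod_0; simpl; lra.
Qed.

Definition l2_zero : l2 := mk_l2 (fun _ => RtoC 0) l2_zero_summable.
Definition l2_plus (a b : l2) : l2 := mk_l2 _ (l2_plus_summable a b).
Definition l2_scal (c : C) (a : l2) : l2 := mk_l2 _ (l2_scal_summable c a).
Definition l2_opp (a : l2) : l2 := l2_scal (RtoC (-1)) a.

Definition l2_AbelianMonoid_mixin : AbelianMonoid.mixin_of l2.
Proof.
apply (AbelianMonoid.Mixin l2 l2_plus l2_zero); intros; apply l2_ext; intro n; unfold Re, Im; simpl; ring.
Defined.
Canonical l2_AbelianMonoid := AbelianMonoid.Pack l2 l2_AbelianMonoid_mixin l2.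

Definition l2_AbelianGroup_mixin : AbelianGroup.mixin_of l2_AbelianMonoid.
Proof.
apply (AbelianGroup.Mixin l2_AbelianMonoid l2_opp); intro x.
apply l2_ext; intro n; unfold Re, Im; simpl; ring.
Defined.
Canonical l2_AbelianGroup := AbelianGroup.Pack l2
  (AbelianGroup.Class l2 l2_AbelianMonoid_mixin l2_AbelianGroup_mixin) l2.

Definition l2_ModuleSpace_mixin : ModuleSpace.mixin_of C_Ring l2_AbelianGroup.
Proof.
apply (ModuleSpace.Mixin C_Ring l2_AbelianGroup l2_scal);
  intros; apply l2_ext; intro n; simpl; unfold mult, plus, one; simpl; ring.
Defined.
Definition l2_ModuleSpace_class : ModuleSpace.class_of C_Ring l2 :=
  ModuleSpace.Class C_Ring l2
    (AbelianGroup.Class l2 l2_AbelianMonoid_mixin l2_AbelianGroup_mixin)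
    l2_ModuleSpace_mixin.
Canonical l2_ModuleSpace := ModuleSpace.Pack C_Ring l2 l2_ModuleSpace_class l2.

Definition l2_inner (a b : l2) : C :=
  (Series (fun n => Re (Cmult (a n) (Cconj (b n)))),
   Series (fun n => Im (Cmult (a n) (Cconj (b n))))).

Definition l2_norm (a : l2) : R := sqrt (Series (fun n => Cmod (a n) ^ 2)).

Lemma l2_inner_summable (a b : l2) :
  ex_series (fun n => Re (Cmult (a n) (Cconj (b n)))) /\
  ex_series (fun n => Im (Cmult (a n) (Cconj (b n)))).
Proof.
assert (E : ex_series (fun n => Cmod (a n) ^ 2 + Cmod (b n) ^ 2)).
{ apply (ex_series_plus (V := R_NormedModule)); apply l2_summable. }
assert (D : forall u v : R, u <= v -> - u <= v -> Rabs u <= v).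
{ intros u v H1 H2; apply Rabs_le; lra. }
split; apply (ex_series_le (V := R_CompleteNormedModule)) with (2 := E); intro n;
  rewrite !Cmod2_alt; destruct (a n) as [x y], (b n) as [u v];
  unfold norm; simpl; unfold abs; simpl;
  pose proof (pow2_ge_0 (x - u)); pose proof (pow2_ge_0 (y - v));
  pose proof (pow2_ge_0 (x + u)); pose proof (pow2_ge_0 (y + v));
  pose proof (pow2_ge_0 (x - v)); pose proof (pow2_ge_0 (y - u));
  pose proof (pow2_ge_0 (x + v)); pose proof (pow2_ge_0 (y + u));
  apply D; nra.
Qed.

Lemma l2_inner_plus_l (a b c : l2) :
  l2_inner (l2_plus a b) c = Cplus (l2_inner a c) (l2_inner b c).
Proof.
destruct (l2_inner_summable a c), (l2_inner_summable b c).
unfold l2_inner, Cplus; simpl; f_equal; rewrite <- Series_plus by assumption;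
  apply Series_ext; intro n; unfold Re, Im; simpl; ring.
Qed.

Lemma l2_inner_scal_l (k : C) (a b : l2) :
  l2_inner (l2_scal k a) b = Cmult k (l2_inner a b).
Proof.
destruct (l2_inner_summable a b) as [H1 H2].
unfold l2_inner, Cmult at 3; simpl; f_equal; rewrite <- !Series_scal_l.
- rewrite <- Series_minus.
  + apply Series_ext; intro n; unfold Re, Im; simpl; ring.
  + exact (ex_series_scal_l (fst k) _ H1).
  + exact (ex_series_scal_l (snd k) _ H2).
- rewrite <- Series_plus.
  + apply Series_ext; intro n; unfold Re, Im; simpl; ring.
  + exact (ex_series_scal_l (fst k) _ H2).
  + exact (ex_series_scal_l (snd k) _ H1).
Qed.

Lemma l2_inner_conj (a b : l2) : l2_inner b a = Cconj (l2_inner a b).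
Proof.
unfold l2_inner, Cconj at 3; simpl; f_equal.
- apply Series_ext; intro n; unfold Re, Im; simpl; ring.
- rewrite <- Series_opp; apply Series_ext; intro n; unfold Re, Im; simpl; ring.
Qed.

Lemma l2_norm_sq (a : l2) : l2_norm a ^ 2 = Series (fun n => Cmod (a n) ^ 2).
Proof.
unfold l2_norm; apply pow2_sqrt, Series_nonneg.
- intro; apply Cmod2_nonneg.
- apply l2_summable.
Qed.

Lemma l2_norm_nonneg (a : l2) : 0 <= l2_norm a.
Proof. apply sqrt_pos. Qed.

Lemma l2_inner_norm (a : l2) : l2_inner a a = RtoC (l2_norm a ^ 2).
Proof.
rewrite l2_norm_sq; unfold l2_inner, RtoC; f_equal.
- apply Series_ext; intro n; rewrite Cmod2_alt; unfold Re, Im; simpl; ring.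
- transitivity (Series (fun n => 0 * Cmod (a n) ^ 2)).
  + apply Series_ext; intro n; unfold Re, Im; simpl; ring.
  + rewrite Series_scal_l; ring.
Qed.

Lemma Cmod_le_l2_norm (a : l2) n : Cmod (a n) <= l2_norm a.
Proof.
apply Rsqr_incr_0_var; [|apply l2_norm_nonneg].
rewrite !Rsqr_pow2, l2_norm_sq.
apply Rle_trans with (sum_n (fun n => Cmod (a n) ^ 2) n).
- destruct n; [rewrite sum_O; lra|].
  rewrite sum_Sn; unfold plus; simpl AbelianMonoid.plus.
  pose proof (sum_n_nonneg (fun n => Cmod (a n) ^ 2) n (fun k => Cmod2_nonneg _)).
  simpl in *; lra.
- apply sum_n_le_Series; [intro; apply Cmod2_nonneg | apply l2_summable].
Qed.

Lemma l2_norm_eq_0 (a : l2) : l2_norm a = 0 -> a = l2_zero.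
Proof.
intro E; apply l2_ext; intro n; simpl; apply Cmod_eq_0.
pose proof (Cmod_le_l2_norm a n); pose proof (Cmod_ge_0 (a n)); lra.
Qed.

Lemma l2_norm_scal (c : C) (a : l2) : l2_norm (l2_scal c a) = Cmod c * l2_norm a.
Proof.
unfold l2_norm; rewrite <- (sqrt_pow2 (Cmod c)) at 1 by apply Cmod_ge_0.
rewrite <- sqrt_mult_alt by apply pow2_ge_0.
f_equal; rewrite <- Series_scal_l; apply Series_ext; intro n; simpl l2_seq.
rewrite Cmod_mult; ring.
Qed.

Lemma l2_norm_combination (s t : R) (a b : l2) :
  l2_norm (l2_plus (l2_scal (RtoC s) a) (l2_scal (RtoC t) b)) ^ 2 =
  s ^ 2 * l2_norm a ^ 2 + 2 * s * t * Re (l2_inner a b) + t ^ 2 * l2_norm b ^ 2.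
Proof.
pose proof (l2_inner_norm (l2_plus (l2_scal (RtoC s) a) (l2_scal (RtoC t) b))) as E.
rewrite l2_inner_plus_l, !l2_inner_scal_l in E.
rewrite (l2_inner_conj _ a), (l2_inner_conj _ b) in E.
rewrite !l2_inner_plus_l, !l2_inner_scal_l, !l2_inner_norm in E.
rewrite (l2_inner_conj a b) in E.
apply (f_equal Re) in E; simpl in E; simpl; nra.
Qed.

Lemma l2_Cauchy_Schwarz_Re (a b : l2) : Re (l2_inner a b) <= l2_norm a * l2_norm b.
Proof.
assert (Z : forall c d : l2, Re (l2_inner (l2_scal (RtoC 0) c) d) = 0)
  by (intros c d; rewrite l2_inner_scal_l; simpl; ring).
assert (E0 : forall c : l2, 0 = l2_norm c -> c = l2_scal (RtoC 0) c).
{ intros c Hc; symmetry in Hc; apply l2_norm_eq_0 in Hc; subst c.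
  apply l2_ext; intro n; simpl; ring. }
pose proof (l2_norm_nonneg a) as [Ha|Ha];
  [pose proof (l2_norm_nonneg b) as [Hb|Hb]|].
- pose proof (l2_norm_combination (l2_norm b) (- l2_norm a) a b) as E.
  pose proof (pow2_ge_0 (l2_norm (l2_plus (l2_scal (RtoC (l2_norm b)) a)
     (l2_scal (RtoC (- l2_norm a)) b)))) as P.
  rewrite E in P; apply Rmult_le_reg_l with (2 * (l2_norm a * l2_norm b)); nra.
- rewrite <- Hb, Rmult_0_r, (E0 b Hb), l2_inner_conj.
  change (Re (l2_inner (l2_scal (RtoC 0) b) a) <= 0); rewrite Z; lra.
- rewrite <- Ha, Rmult_0_l, (E0 a Ha), Z; lra.
Qed.

Lemma l2_norm_triangle (a b : l2) : l2_norm (l2_plus a b) <= l2_norm a + l2_norm b.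
Proof.
pose proof (l2_norm_nonneg a); pose proof (l2_norm_nonneg b).
apply Rsqr_incr_0_var; [|lra].
rewrite !Rsqr_pow2.
replace (l2_plus a b) with (l2_plus (l2_scal (RtoC 1) a) (l2_scal (RtoC 1) b))
  by (apply l2_ext; intro n; simpl; ring).
rewrite l2_norm_combination; pose proof (l2_Cauchy_Schwarz_Re a b); nra.
Qed.

Definition l2_dist (a b : l2) : R := l2_norm (l2_plus b (l2_opp a)).

Lemma l2_dist_sym (a b : l2) : l2_dist a b = l2_dist b a.
Proof.
unfold l2_dist.
replace (l2_plus b (l2_opp a)) with (l2_scal (RtoC (-1)) (l2_plus a (l2_opp b)))
  by (apply l2_ext; intro n; simpl; ring).
rewrite l2_norm_scal, Cmod_R, Rabs_left by lra; ring.
Qed.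

Lemma l2_dist_triangle (a b c : l2) : l2_dist a c <= l2_dist a b + l2_dist b c.
Proof.
unfold l2_dist.
replace (l2_plus c (l2_opp a))
  with (l2_plus (l2_plus b (l2_opp a)) (l2_plus c (l2_opp b)))
  by (apply l2_ext; intro n; simpl; ring).
apply l2_norm_triangle.
Qed.

Lemma l2_dist_refl (a : l2) : l2_dist a a = 0.
Proof.
unfold l2_dist.
replace (l2_plus a (l2_opp a)) with (l2_scal (RtoC 0) a)
  by (apply l2_ext; intro n; simpl; ring).
rewrite l2_norm_scal, Cmod_0; ring.
Qed.

Definition l2_UniformSpace_mixin : UniformSpace.mixin_of l2.
Proof.
apply (UniformSpace.Mixin l2 l2_zero (fun a e b => l2_dist a b < e)).
- intros x e; rewrite l2_dist_refl; apply cond_pos.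
- intros x y e; rewrite l2_dist_sym; trivial.
- intros x y z e1 e2 H1 H2; pose proof (l2_dist_triangle x y z); lra.
Defined.
Canonical l2_UniformSpace := UniformSpace.Pack l2 l2_UniformSpace_mixin l2.

Canonical l2_NormedModuleAux := NormedModuleAux.Pack C_AbsRing l2
  (NormedModuleAux.Class C_AbsRing l2 l2_ModuleSpace_class l2_UniformSpace_mixin) l2.

Definition l2_NormedModule_mixin : NormedModule.mixin_of C_AbsRing l2_NormedModuleAux.
Proof.
apply (NormedModule.Mixin C_AbsRing l2_NormedModuleAux l2_norm 1).
- exact l2_norm_triangle.
- intros c x; right; apply l2_norm_scal.
- intros x y e H; exact H.
- intros x y e H; rewrite Rmult_1_l; exact H.
- exact l2_norm_eq_0.
Defined.
Definition l2_NormedModule_class : NormedModule.class_of C_AbsRing l2 :=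
  NormedModule.Class C_AbsRing l2
    (NormedModuleAux.Class C_AbsRing l2 l2_ModuleSpace_class l2_UniformSpace_mixin)
    l2_NormedModule_mixin.
Canonical l2_NormedModule := NormedModule.Pack C_AbsRing l2 l2_NormedModule_class l2.

Lemma l2_sum_n_le (a : l2) n : sum_n (fun k => Cmod (a k) ^ 2) n <= l2_norm a ^ 2.
Proof.
rewrite l2_norm_sq; apply sum_n_le_Series;
  [intro; apply Cmod2_nonneg | apply l2_summable].
Qed.

Lemma is_lim_seq_inv_succ : is_lim_seq (fun k => / INR (S k)) 0.
Proof.
apply (is_lim_seq_incr_1 (fun k => / INR k)).
apply (is_lim_seq_inv INR p_infty); [apply is_lim_seq_INR | discriminate].
Qed.

Lemma l2_seq_complete (x : nat -> l2) :
  (forall j k, l2_dist (x j) (x k) <= / INR (S j) + / INR (S k)) ->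
  exists l : l2, forall j, l2_dist (x j) l <= / INR (S j).
Proof.
intro Hx.
assert (Hpos : forall j, 0 < / INR (S j)) by (intro; apply Rinv_0_lt_compat, lt_0_INR; lia).
assert (Hc : forall n j k,
  Cmod (Cminus (x k n) (x j n)) <= / INR (S j) + / INR (S k)).
{ intros n j k; refine (Rle_trans _ _ _ _ (Hx j k)).
  unfold l2_dist; refine (Rle_trans _ _ _ _ (Cmod_le_l2_norm _ n)).
  simpl; right; f_equal; ring. }
assert (Hcauchy : forall f : C -> R,
  (forall u v, Rabs (f u - f v) <= Cmod (Cminus u v)) ->
  forall n, is_lim_seq (fun k => f (x k n)) (real (Lim_seq (fun k => f (x k n))))).
{ intros f Hf n; apply Lim_seq_correct', ex_lim_seq_cauchy_corr; intro eps.
  pose proof is_lim_seq_inv_succ as L; apply is_lim_seq_spec in L.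
  destruct (L (pos_div_2 eps)) as [N HN]; exists N; intros p q Hp Hq.
  apply Rle_lt_trans with (1 := Hf _ _), Rle_lt_trans with (1 := Hc n q p).
  pose proof (HN p Hp) as Hp'; pose proof (HN q Hq) as Hq'; simpl pos in *.
  rewrite Rminus_0_r, Rabs_pos_eq in Hp', Hq' by (left; apply Hpos); lra. }
set (l := fun n => (real (Lim_seq (fun k => Re (x k n))),
                    real (Lim_seq (fun k => Im (x k n)))) : C).
assert (HRe : forall n, is_lim_seq (fun k => Re (x k n)) (Re (l n))).
{ apply (Hcauchy Re); intros u v; replace (Re u - Re v) with (Re (Cminus u v))
    by (unfold Re, Im; simpl; ring); apply re_le_Cmod. }
assert (HIm : forall n, is_lim_seq (fun k => Im (x k n)) (Im (l n))).
{ apply (Hcauchy Im); intros u v; replace (Im u - Im v) with (Im (Cminus u v))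
    by (unfold Re, Im; simpl; ring).
  pose proof (Rmax_Cmod (Cminus u v)) as P; refine (Rle_trans _ _ _ _ P); apply Rmax_r. }
assert (Hsum : forall j n,
  sum_n (fun m => Cmod (Cminus (l m) (x j m)) ^ 2) n <= (/ INR (S j)) ^ 2).
{ intros j n.
  apply (is_lim_seq_le
    (fun k => sum_n (fun m => Cmod (Cminus (x k m) (x j m)) ^ 2) n)
    (fun k => (/ INR (S j) + / INR (S k)) ^ 2)
    (Finite (sum_n (fun m => Cmod (Cminus (l m) (x j m)) ^ 2) n))
    (Finite ((/ INR (S j)) ^ 2))).
  - intro k; apply Rle_trans with (l2_dist (x j) (x k) ^ 2).
    + refine (Rle_trans _ _ _ _ (l2_sum_n_le _ n)); right; apply sum_n_ext; intro m.
      simpl l2_seq; do 2 f_equal; ring.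
    + apply pow_incr; split; [apply l2_norm_nonneg | apply Hx].
  - assert (T : forall m, is_lim_seq (fun k => Cmod (Cminus (x k m) (x j m)) ^ 2)
       (Cmod (Cminus (l m) (x j m)) ^ 2)).
    { intro m; rewrite Cmod2_alt.
      apply is_lim_seq_ext with (fun k => (Re (x k m) - Re (x j m)) *
         (Re (x k m) - Re (x j m)) + (Im (x k m) - Im (x j m)) *
         (Im (x k m) - Im (x j m))).
      { intro k; rewrite Cmod2_alt; unfold Re, Im; simpl; ring. }
      replace (Re (Cminus (l m) (x j m)) ^ 2 + Im (Cminus (l m) (x j m)) ^ 2)
        with ((Re (l m) - Re (x j m)) * (Re (l m) - Re (x j m)) +
              (Im (l m) - Im (x j m)) * (Im (l m) - Im (x j m)))
        by (unfold Re, Im; simpl; ring).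
      assert (A : is_lim_seq (fun k => Re (x k m) - Re (x j m)) (Re (l m) - Re (x j m)))
        by (apply is_lim_seq_minus'; [apply HRe | apply is_lim_seq_const]).
      assert (B : is_lim_seq (fun k => Im (x k m) - Im (x j m)) (Im (l m) - Im (x j m)))
        by (apply is_lim_seq_minus'; [apply HIm | apply is_lim_seq_const]).
      apply is_lim_seq_plus'; apply is_lim_seq_mult'; assumption. }
    induction n as [|n IH].
    + rewrite sum_O; apply is_lim_seq_ext with (2 := T O).
      intro k; rewrite sum_O; reflexivity.
    + rewrite sum_Sn; unfold plus; simpl AbelianMonoid.plus.
      apply is_lim_seq_ext with (fun k =>
        sum_n (fun m => Cmod (Cminus (x k m) (x j m)) ^ 2) n +
        Cmod (Cminus (x k (S n)) (x j (S n))) ^ 2).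
      * intro k; rewrite sum_Sn; reflexivity.
      * apply is_lim_seq_plus'; [exact IH | apply T].
  - apply is_lim_seq_ext with (fun k => (/ INR (S j) + / INR (S k)) *
      (/ INR (S j) + / INR (S k))); [intro; ring|].
    replace ((/ INR (S j)) ^ 2) with ((/ INR (S j) + 0) * (/ INR (S j) + 0)) by ring.
    apply is_lim_seq_mult'; apply is_lim_seq_plus';
      solve [apply is_lim_seq_const | apply is_lim_seq_inv_succ]. }
assert (Hd : ex_series (fun m => Cmod (Cminus (l m) (x O m)) ^ 2)).
{ apply ex_series_bounded with ((/ INR 1) ^ 2); [intro; apply Cmod2_nonneg | apply Hsum]. }
assert (Hl : ex_series (fun m => Cmod (l m) ^ 2)).
{ pose proof (l2_plus_summable (mk_l2 _ Hd) (x O)) as P.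
  apply ex_series_ext with (2 := P); intro m; simpl l2_seq; do 2 f_equal; ring. }
exists (mk_l2 l Hl); intro j; unfold l2_dist.
apply Rsqr_incr_0_var; [|left; apply Hpos].
rewrite !Rsqr_pow2, l2_norm_sq; apply Series_bounded.
- intro; apply Cmod2_nonneg.
- intro n; refine (Rle_trans _ _ _ _ (Hsum j n)); right; apply sum_n_ext; intro m.
  simpl l2_seq; do 2 f_equal; ring.
Qed.

Lemma l2_cauchy_filter (F : (l2 -> Prop) -> Prop) :
  ProperFilter F -> cauchy F ->
  exists l : l2, forall eps : posreal, F (fun y => l2_dist l y < eps).
Proof.
intros PF HF.
assert (Hpos : forall j, 0 < / INR (S j)) by (intro; apply Rinv_0_lt_compat, lt_0_INR; lia).
assert (Hx : forall j : nat, exists x, F (fun y => l2_dist x y < / INR (S j)))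
  by (intro j; apply (HF (mkposreal _ (Hpos j)))).
pose (x := fun j => proj1_sig (constructive_indefinite_description _ (Hx j))).
assert (Fx : forall j, F (fun y => l2_dist (x j) y < / INR (S j)))
  by (intro j; unfold x; apply proj2_sig).
destruct (l2_seq_complete x) as [l Hl].
{ intros j k; destruct (filter_ex _ (filter_and _ _ (Fx j) (Fx k))) as [y [Hj Hk]].
  pose proof (l2_dist_triangle (x j) y (x k)); rewrite (l2_dist_sym y) in H; lra. }
exists l; intro eps.
pose proof is_lim_seq_inv_succ as L; apply is_lim_seq_spec in L.
destruct (L (pos_div_2 eps)) as [N HN]; specialize (HN N (Nat.le_refl N)).
rewrite Rminus_0_r, Rabs_pos_eq in HN by (left; apply Hpos); simpl pos in HN.
apply filter_imp with (2 := Fx N); intros y Hy.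
pose proof (l2_dist_triangle l (x N) y); specialize (Hl N).
rewrite (l2_dist_sym l (x N)) in H; lra.
Qed.

Definition l2_lim (F : (l2 -> Prop) -> Prop) : l2 :=
  epsilon (inhabits l2_zero) (fun l => forall eps : posreal, F (fun y => l2_dist l y < eps)).

Definition l2_CompleteSpace_mixin : CompleteSpace.mixin_of l2_UniformSpace.
Proof.
apply (CompleteSpace.Mixin l2_UniformSpace l2_lim).
- intros F PF HF; exact (epsilon_spec _ _ (l2_cauchy_filter F PF HF)).
- intros F1 F2 H12 H21.
  assert (F1 = F2) as ->
    by (apply functional_extensionality; intro P; apply propositional_extensionality;
        split; [apply H21 | apply H12]).
  intro eps; apply ball_center.
Defined.
Canonical l2_CompleteNormedModule := CompleteNormedModule.Pack C_AbsRing l2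
  (CompleteNormedModule.Class C_AbsRing l2 l2_NormedModule_class l2_CompleteSpace_mixin) l2.

Canonical l2_Hilbert : HilbertSpace := Build_HilbertSpace l2_CompleteNormedModule
  l2_inner l2_inner_plus_l l2_inner_scal_l l2_inner_conj l2_inner_norm.

Definition shift_seq (a : nat -> C) (n : nat) : C :=
  match n with O => RtoC 0 | S m => a m end.

Lemma forward_shift_summable (a : l2) : ex_series (fun n => Cmod (shift_seq a n) ^ 2).
Proof.
apply (ex_series_incr_1 (fun n => Cmod (shift_seq a n) ^ 2)), (l2_summable a).
Qed.

Lemma backward_shift_summable (a : l2) : ex_series (fun n => Cmod (a (S n)) ^ 2).
Proof.
apply (ex_series_incr_1 (fun n => Cmod (a n) ^ 2)), (l2_summable a).
Qed.

Definition forward_shift (a : l2_Hilbert) : l2_Hilbert := mk_l2 _ (forward_shift_summable a).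
Definition backward_shift (a : l2_Hilbert) : l2_Hilbert := mk_l2 _ (backward_shift_summable a).

Lemma backward_shift_adjoint : is_adjoint forward_shift backward_shift.
Proof.
intros a b; change (l2_inner (forward_shift a) b = l2_inner a (backward_shift b)).
destruct (l2_inner_summable (forward_shift a) b) as [H1 H2].
unfold l2_inner; f_equal; rewrite Series_incr_1 by assumption; simpl; ring.
Qed.

(* Main.v *)
Require Import Defs.
From Stdlib Require Import Reals Lra Lia Classical ClassicalEpsilon.
From Coquelicot Require Import Coquelicot.
Open Scope R_scope.

(** Write [A] for the adjoint of [T] and [s = 1 - |zeta|^2].  A frame [gamma] normalized
    by [<gamma v, gamma zeta> = 1] gives vectors [x = gamma zeta], [u = gamma' zeta] with
    [T x = zeta x], [T u = zeta u + x], [u] orthogonal to [x], [norm x = 1], and the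
    curvature at [zeta] is [- norm u ^ 2].  Extremality [norm u = 1 / s] forces
    [A T g = g] for [g = s u + conj zeta x].  Since [A] is a 2 hyper-contraction, the
    subspace [{f | T A f = f}] is invariant under [A]; it contains [T g], hence [x], hence
    [e = x - zeta A x], which spans the kernel of [T].  The vectors [A^n e] are orthogonal
    of equal norm and [T] shifts them backwards.  The eigenspaces of [T] are
    one-dimensional, so they are spanned by the sums [sum w^n A^n e], and these
    eigenvectors span the whole space. *)

(** Coquelicot infers the algebraic structure of [plus x y] from the shape of [x], so
    that convertible vectors need not match syntactically; these notations fix it. *)
Notation "x [+] y" :=
  (@plus (CompleteNormedModule.AbelianMonoid C_AbsRing (hilbert_carrier _)) x y)
  (at level 50, left associativity).
Notation "x [-] y" :=
  (@minus (CompleteNormedModule.AbelianGroup C_AbsRing (hilbert_carrier _)) x y)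
  (at level 50, left associativity).
Notation "c [*] x" :=
  (@scal C_Ring (CompleteNormedModule.ModuleSpace C_AbsRing (hilbert_carrier _)) c x)
  (at level 40, left associativity).
Notation "[0]" := (@zero (CompleteNormedModule.AbelianMonoid C_AbsRing (hilbert_carrier _))).

(** The vectors [x] and [u] span a subspace invariant under [T]; in the orthonormal basis [x],
    [u / norm u] the restriction is the matrix with rows [(zeta, 1 / norm u)] and [(0, zeta)]. It is
    a contraction exactly when [1 / norm u <= s], so contractivity bounds the curvature by
    [- 1 / s^2]. The hypothesis is the equality case: the restriction then has norm 1, and [g] is a
    vector at which this norm is attained. Two obstacles shape the proof. The curvature hypothesis
    speaks of holomorphic frames, so one must be built near [zeta], together with its derivative.
    The definition of the class offers closed ranges and one-dimensional kernels; an open mapping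
    argument turns them into lower bounds for [T - v] on the orthogonal complement of [x], uniform
    for [v] near [zeta]. Secondly, a contraction that preserves the norm of one vector need not
    preserve that of its image. The second positivity condition supplies this propagation and
    carries information at a single point [zeta] along a whole orbit of [A]. *)

Lemma inner_plus_r {H : HilbertSpace} (x y z : H) :
  inner x (y [+] z) = Cplus (inner x y) (inner x z).
Proof.
rewrite inner_conj, inner_plus_l, Cplus_conj, <- !(inner_conj H); reflexivity.
Qed.

Lemma inner_scal_r {H : HilbertSpace} (c : C) (x y : H) :
  inner x (c [*] y) = Cmult (Cconj c) (inner x y).
Proof.
rewrite inner_conj, inner_scal_l, Cmult_conj, <- (inner_conj H); reflexivity.
Qed.

Lemma minus_scal {H : HilbertSpace} (x y : H) : x [-] y = x [+] (Copp (RtoC 1)) [*] y.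
Proof.
unfold minus; f_equal; symmetry.
exact (scal_opp_one (V := CompleteNormedModule.ModuleSpace C_AbsRing H) y).
Qed.

Lemma zero_scal {H : HilbertSpace} : ([0] : H) = RtoC 0 [*] zero.
Proof.
symmetry; exact (scal_zero_r (V := CompleteNormedModule.ModuleSpace C_AbsRing H) (RtoC 0)).
Qed.

Lemma inner_minus_l {H : HilbertSpace} (x y z : H) :
  inner (x [-] y) z = Cminus (inner x z) (inner y z).
Proof. rewrite minus_scal, inner_plus_l, inner_scal_l; ring. Qed.

Lemma inner_minus_r {H : HilbertSpace} (x y z : H) :
  inner x (y [-] z) = Cminus (inner x y) (inner x z).
Proof.
rewrite inner_conj, inner_minus_l, Cminus_conj, <- !(inner_conj H); reflexivity.
Qed.

Lemma inner_zero_l {H : HilbertSpace} (x : H) : inner [0] x = RtoC 0.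
Proof. rewrite zero_scal, inner_scal_l; ring. Qed.

Lemma inner_zero_r {H : HilbertSpace} (x : H) : inner x [0] = RtoC 0.
Proof. rewrite inner_conj, inner_zero_l; unfold Cconj, RtoC; simpl; f_equal; ring. Qed.

Lemma norm_sqr {H : HilbertSpace} (x : H) : norm x ^ 2 = Re (inner x x).
Proof. rewrite inner_norm; reflexivity. Qed.

Lemma norm_0 {H : HilbertSpace} : norm ([0] : H) = 0.
Proof. exact norm_zero. Qed.

Lemma norm_eq_0 {H : HilbertSpace} (x : H) : norm x = 0 -> x = [0].
Proof. intro E; exact (norm_eq_zero _ E). Qed.

Lemma inner_ext {H : HilbertSpace} (x y : H) :
  (forall z, inner x z = inner y z) -> x = y.
Proof.
intro E.
assert (Z : norm (x [-] y) = 0).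
{ assert (Q : norm (x [-] y) ^ 2 = 0).
  { rewrite norm_sqr, inner_minus_l, E; unfold Re; simpl; ring. }
  pose proof (norm_ge_0 (x [-] y)); nra. }
apply norm_eq_0 in Z; apply (plus_reg_r (opp y)).
rewrite plus_opp_r; exact Z.
Qed.

Ltac expand_inner :=
  rewrite ?inner_minus_l, ?inner_minus_r, ?inner_plus_l, ?inner_plus_r,
    ?inner_scal_l, ?inner_scal_r, ?inner_zero_l, ?inner_zero_r.

(** Vector identities are checked against all test vectors, which turns them into
    identities in the field of complex numbers. *)
Ltac vector := apply inner_ext; let z := fresh "z" in intro z;
  repeat progress expand_inner; try ring.

Lemma norm_scal_eq {H : HilbertSpace} (c : C) (x : H) :
  norm (c [*] x) = Cmod c * norm x.
Proof.
assert (Q : norm (c [*] x) ^ 2 = (Cmod c * norm x) ^ 2).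
{ rewrite Rpow_mult_distr, norm_sqr, inner_scal_l, inner_scal_r, inner_norm.
  rewrite Cmod2_alt; destruct c as [a b]; unfold Re, Im; simpl; ring. }
pose proof (norm_ge_0 (c [*] x)); pose proof (norm_ge_0 x); pose proof (Cmod_ge_0 c).
assert (0 <= Cmod c * norm x) by (apply Rmult_le_pos; assumption); nra.
Qed.

Lemma norm_sqr_plus {H : HilbertSpace} (x y : H) :
  norm (x [+] y) ^ 2 = norm x ^ 2 + 2 * Re (inner x y) + norm y ^ 2.
Proof.
rewrite !norm_sqr, inner_plus_l, !inner_plus_r, (inner_conj H x y).
unfold Re; simpl; ring.
Qed.

Lemma norm_sqr_minus {H : HilbertSpace} (x y : H) :
  norm (x [-] y) ^ 2 = norm x ^ 2 - 2 * Re (inner x y) + norm y ^ 2.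
Proof.
rewrite !norm_sqr, inner_minus_l, !inner_minus_r, (inner_conj H x y).
unfold Re; simpl; ring.
Qed.

Lemma norm_plus_le {H : HilbertSpace} (x y : H) : norm (x [+] y) <= norm x + norm y.
Proof. exact (norm_triangle x y). Qed.

Lemma norm_minus_sym {H : HilbertSpace} (x y : H) : norm (x [-] y) = norm (y [-] x).
Proof.
replace (x [-] y) with (Copp (RtoC 1) [*] (y [-] x)) by vector.
rewrite norm_scal_eq, Cmod_m1; ring.
Qed.

Lemma norm_minus_le {H : HilbertSpace} (x y z : H) :
  norm (x [-] z) <= norm (x [-] y) + norm (y [-] z).
Proof.
replace (x [-] z) with ((x [-] y) [+] (y [-] z)) by vector; apply norm_plus_le.
Qed.

Lemma norm_gt_0 {H : HilbertSpace} (x : H) : x <> [0] -> 0 < norm x.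
Proof.
intro Hx; destruct (norm_ge_0 x) as [P|P]; [exact P|].
elim Hx; apply norm_eq_0; symmetry; exact P.
Qed.

Lemma Cauchy_Schwarz {H : HilbertSpace} (x y : H) : Cmod (inner x y) <= norm x * norm y.
Proof.
pose proof (norm_ge_0 x) as Px; pose proof (norm_ge_0 y) as Py.
destruct Py as [Py|Py].
(* This vector is [norm y ^ 2] times the component of [x] orthogonal to [y], with the denominator
   cleared. *)
- pose proof (pow2_ge_0 (norm (RtoC (norm y ^ 2) [*] x [-] inner x y [*] y))) as P.
  rewrite norm_sqr_minus, !norm_scal_eq, inner_scal_l, inner_scal_r in P.
  assert (E : Re (RtoC (norm y ^ 2) * (Cconj (inner x y) * inner x y)) =
              norm y ^ 2 * Cmod (inner x y) ^ 2).
  { rewrite Cmod2_alt; destruct (inner x y) as [a b]; unfold Re, Im; simpl; ring. }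
  rewrite E, Cmod_R, Rabs_pos_eq in P by apply pow2_ge_0.
  pose proof (Cmod_ge_0 (inner x y)) as Pi.
  assert (Q : Cmod (inner x y) ^ 2 <= (norm x * norm y) ^ 2).
  { apply Rmult_le_reg_l with (norm y ^ 2); [apply pow_lt; exact Py|nra]. }
  apply Rsqr_incr_0_var; [rewrite !Rsqr_pow2; exact Q|].
  apply Rmult_le_pos; lra.
- symmetry in Py; apply norm_eq_0 in Py; subst y.
  rewrite inner_zero_r, Cmod_0; apply Rmult_le_pos; [lra|apply norm_ge_0].
Qed.

Lemma Re_inner_le {H : HilbertSpace} (x y : H) : Re (inner x y) <= norm x * norm y.
Proof.
refine (Rle_trans _ _ _ _ (Cauchy_Schwarz x y)).
refine (Rle_trans _ _ _ (Rle_abs _) (re_le_Cmod _)).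
Qed.

Lemma closed_limit {H : HilbertSpace} (S : H -> Prop) (x : H) :
  closed S -> (forall eps, 0 < eps -> exists y, S y /\ norm (y [-] x) < eps) -> S x.
Proof.
intros HS Hx; apply HS; intro L.
destruct (locally_norm_le_locally x _ L) as [eps Heps].
destruct (Hx eps (cond_pos eps)) as [y [Sy Hy]].
exact (Heps y Hy Sy).
Qed.

Lemma linear_map_plus {H1 H2 : HilbertSpace} (L : H1 -> H2) : is_linear L ->
  forall x y, L (x [+] y) = L x [+] L y.
Proof. intros HL x y; exact (linear_plus L HL x y). Qed.

Lemma linear_map_scal {H1 H2 : HilbertSpace} (L : H1 -> H2) : is_linear L ->
  forall c x, L (c [*] x) = c [*] L x.
Proof. intros HL c x; exact (linear_scal L HL c x). Qed.

Lemma linear_map_minus {H1 H2 : HilbertSpace} (L : H1 -> H2) : is_linear L ->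
  forall x y, L (x [-] y) = L x [-] L y.
Proof.
intros HL x y; rewrite !minus_scal, linear_map_plus, linear_map_scal by assumption.
reflexivity.
Qed.

(** * Convergence controlled by geometric series *)

Lemma geometric_small (M eps : R) : 0 < eps ->
  exists N, forall n, (N <= n)%nat -> M * (/ 2) ^ n < eps.
Proof.
intro He.
pose proof (is_lim_seq_geom (/ 2)) as L.
rewrite Rabs_pos_eq in L by lra.
specialize (L ltac:(lra)).
apply (is_lim_seq_scal_l _ M) in L; simpl in L; rewrite Rmult_0_r in L.
apply is_lim_seq_spec in L; destruct (L (mkposreal eps He)) as [N HN].
exists N; intros n Hn; specialize (HN n Hn); simpl in HN.
rewrite Rminus_0_r in HN; apply Rle_lt_trans with (2 := HN), Rle_abs.
Qed.

Lemma is_series_norm {H : HilbertSpace} (a : nat -> H) (l : H) :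
  is_series a l <->
  forall eps, 0 < eps -> exists N, forall n, (N <= n)%nat -> norm (sum_n a n [-] l) < eps.
Proof.
split.
- intros Hl eps Heps.
  pose proof (proj1 (filterlim_locally_ball_norm (F := eventually) (sum_n a) l) Hl) as E.
  exact (E (mkposreal eps Heps)).
- intro E; apply (proj2 (filterlim_locally_ball_norm (F := eventually) (sum_n a) l)).
  intro eps; exact (E eps (cond_pos eps)).
Qed.

Lemma sum_telescope {H : HilbertSpace} (u : nat -> H) n :
  sum_n (fun n => u (S n) [-] u n) n = u (S n) [-] u O.
Proof.
induction n as [|n IH]; [apply sum_O|].
rewrite sum_Sn, IH; vector.
Qed.

Lemma geometric_steps_converge {H : HilbertSpace} (u : nat -> H) (M : R) :
  (forall n, norm (u (S n) [-] u n) <= M * (/ 2) ^ n) ->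
  exists l, forall n, norm (l [-] u n) <= 2 * M * (/ 2) ^ n.
Proof.
intro Hu.
(* Subtracting the exact geometric remainder makes the bound inductive in [m]. *)
assert (D : forall m n, norm (u (n + m)%nat [-] u n)
    <= 2 * M * (/ 2) ^ n - 2 * M * (/ 2) ^ (n + m)).
{ intros m n; induction m as [|m IH].
  - rewrite Nat.add_0_r; replace (u n [-] u n) with ([0] : H) by vector.
    rewrite norm_0; lra.
  - rewrite Nat.add_succ_r; pose proof (norm_minus_le (u (S (n + m))) (u (n + m)%nat) (u n)).
    specialize (Hu (n + m)%nat); simpl pow; lra. }
assert (HM : 0 <= M).
{ specialize (Hu O); pose proof (norm_ge_0 (u 1%nat [-] u O)); simpl in Hu; lra. }
assert (E : ex_series (fun n => u (S n) [-] u n)).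
{ apply (ex_series_le (V := H)) with (1 := Hu).
  apply (ex_series_scal_l M (fun n => (/ 2) ^ n)), ex_series_geom.
  rewrite Rabs_pos_eq; lra. }
destruct E as [l Hl].
exists (l [+] u O); intro n; apply le_epsilon; intros eps Heps.
destruct (proj1 (is_series_norm _ _) Hl eps Heps) as [N HN].
specialize (HN (n + N)%nat ltac:(lia)).
rewrite (sum_telescope u), norm_minus_sym in HN.
replace (l [-] (u (S (n + N)) [-] u O))
  with ((l [+] u O) [-] u (S (n + N))) in HN by vector.
pose proof (norm_minus_le (l [+] u O) (u (S (n + N))) (u n)).
specialize (D (S N) n); rewrite Nat.add_succ_r in D.
assert (0 <= 2 * M * (/ 2) ^ S (n + N)).
{ apply Rmult_le_pos; [lra|apply pow_le; lra]. }
lra.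
Qed.

(** * Operators with closed range *)

(** Baire's argument inside the range, which is complete because it is closed. The images of the
    balls of radius [n] exhaust the range; if none were dense in a ball of the range, nested balls
    avoiding them one after another would shrink to a point of the range lying in no image. Centres
    are carried as preimages so that they stay in the range. *)
Lemma Baire_closed_range {H : HilbertSpace} (L : H -> H) :
  closed (fun y : H => exists x, y = L x) ->
  exists (n : nat) (r : R) (g0 : H), 0 < r /\
    forall g, norm (L g [-] L g0) < r -> forall eps, 0 < eps ->
      exists y, norm y <= INR n /\ norm (L y [-] L g) < eps.
Proof.
intro Hcl; apply NNPP; intro Hno.
(* A pair codes the ball with centre [L (fst p)] and radius [snd p]. The factor 2 leaves a gap: the
   limit of the centres is within [snd q] of [L (fst q)], hence outside the [n]-th image. *)
assert (Step : forall (n : nat) (p : H * posreal), exists q : H * posreal,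
  norm (L (fst q) [-] L (fst p)) <= snd p / 2 /\ snd q <= snd p / 2 /\
  forall y, norm y <= INR n -> 2 * snd q <= norm (L y [-] L (fst q))).
{ intros n [g0 [r Hr]]; simpl; apply NNPP; intro Hq; apply Hno.
  exists n, (r / 2), g0; split; [lra|].
  intros g Hg eps Heps; apply NNPP; intro Hy; apply Hq.
  assert (Hm : 0 < Rmin (r / 2) (eps / 2)) by (apply Rmin_pos; lra).
  exists (g, mkposreal _ Hm); simpl; split; [lra|]; split; [apply Rmin_l|].
  intros y Hyn; pose proof (Rmin_r (r / 2) (eps / 2)).
  destruct (Rle_lt_dec eps (norm (L y [-] L g))) as [P|P]; [lra|].
  elim Hy; exists y; split; assumption. }
pose (step := fun n p => proj1_sig (constructive_indefinite_description _ (Step n p))).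
assert (Hstep : forall n p,
  norm (L (fst (step n p)) [-] L (fst p)) <= snd p / 2 /\
  snd (step n p) <= snd p / 2 /\
  forall y, norm y <= INR n -> 2 * snd (step n p) <= norm (L y [-] L (fst (step n p)))).
{ intros n p; unfold step.
  exact (proj2_sig (constructive_indefinite_description _ (Step n p))). }
pose (s := nat_rect (fun _ => (H * posreal)%type) (zero : H, mkposreal 1 Rlt_0_1) step).
assert (Hs : forall n, s (S n) = step n (s n)) by reflexivity.
assert (Hr : forall n, snd (s n) <= (/ 2) ^ n).
{ induction n as [|n IH]; [simpl; lra|].
  rewrite Hs; destruct (Hstep n (s n)) as [_ [P _]]; simpl pow; lra. }
assert (Hd : forall m n, norm (L (fst (s (n + m)%nat)) [-] L (fst (s n)))
    <= snd (s n) - snd (s (n + m)%nat)).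
{ intros m n; induction m as [|m IH].
  - rewrite Nat.add_0_r; replace (L (fst (s n)) [-] L (fst (s n))) with ([0] : H) by vector.
    rewrite norm_0; lra.
  - rewrite Nat.add_succ_r.
    pose proof (norm_minus_le (L (fst (s (S (n + m))))) (L (fst (s (n + m)%nat))) (L (fst (s n)))).
    rewrite Hs in *; destruct (Hstep (n + m)%nat (s (n + m)%nat)) as [P [Q _]]; lra. }
destruct (geometric_steps_converge (fun n => L (fst (s n))) (/ 2)) as [h Hh].
{ intro n; specialize (Hr n).
  rewrite Hs; destruct (Hstep n (s n)) as [P _]; lra. }
destruct (closed_limit _ h Hcl) as [y Hy].
{ intros eps Heps; destruct (geometric_small (2 * / 2) eps Heps) as [N HN].
  exists (L (fst (s N))); split; [exists (fst (s N)); reflexivity|].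
  rewrite norm_minus_sym; apply Rle_lt_trans with (1 := Hh N), HN; lia. }
subst h.
destruct (archimed (norm y)) as [Hup _].
pose proof (norm_ge_0 y) as Hy0.
assert (Hz : (0 <= up (norm y))%Z) by (apply le_IZR; lra).
destruct (IZN _ Hz) as [n Hn]; rewrite Hn, <- INR_IZR_INZ in Hup.
assert (Hlim : norm (L y [-] L (fst (s (S n)))) <= snd (s (S n))).
{ apply le_epsilon; intros eps Heps.
  destruct (geometric_small (2 * / 2) eps Heps) as [N HN].
  specialize (HN (S n + N)%nat ltac:(lia)); specialize (Hh (S n + N)%nat).
  specialize (Hd N (S n)).
  pose proof (norm_minus_le (L y) (L (fst (s (S n + N)%nat))) (L (fst (s (S n))))).
  pose proof (cond_pos (snd (s (S n + N)%nat))); lra. }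
rewrite Hs in Hlim; destruct (Hstep n (s n)) as [_ [_ P]].
specialize (P y ltac:(lra)); pose proof (cond_pos (snd (step n (s n)))); lra.
Qed.

(** The ball found by Baire has an unknown centre [L g0]. Approximating both [L g0] and [L g0] plus
    a multiple of [L g], then subtracting, cancels it. *)
Lemma closed_range_approximate_preimage {H : HilbertSpace} (L : H -> H) :
  is_linear L -> closed (fun y : H => exists x, y = L x) ->
  exists C, 0 < C /\ forall g, exists y,
    norm y <= C * norm (L g) /\ norm (L (g [-] y)) <= / 2 * norm (L g).
Proof.
intros HL Hcl; destruct (Baire_closed_range L Hcl) as [n [r [g0 [Hr Hn]]]].
pose proof (pos_INR n) as Hn0.
(* Two approximants of norm at most [n], divided by [t = r / (2 * norm (L g))], give
   [4 * n / r * norm (L g)]; adding 1 keeps the constant positive when [n = 0]. *)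
exists (4 * INR n / r + 1).
assert (HC : 0 <= 4 * INR n / r) by (apply Rmult_le_pos; [lra|left; apply Rinv_0_lt_compat, Hr]).
split; [lra|]; intro g.
destruct (norm_ge_0 (L g)) as [Hg|Hg].
(* This scales [L g] to length [r / 2], inside the ball. Two errors of [r / 8] add up to [r / 4],
   which is half of that length. *)
- set (t := r / (2 * norm (L g))).
  assert (Ht : 0 < t) by (apply Rdiv_lt_0_compat; lra).
  assert (Et : t * norm (L g) = r / 2) by (unfold t; field; lra).
  assert (Et' : / t = 2 * norm (L g) / r) by (unfold t; field; lra).
  assert (Ct : RtoC t <> RtoC 0) by (intro E; apply RtoC_inj in E; lra).
  set (g1 := g0 [+] RtoC t [*] g).
  destruct (Hn g1) with (eps := r / 8) as [y1 [Hy1 Hd1]]; [|lra|].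
  { unfold g1; rewrite linear_map_plus, linear_map_scal by assumption.
    replace (L g0 [+] RtoC t [*] L g [-] L g0) with (RtoC t [*] L g) by vector.
    rewrite norm_scal_eq, Cmod_R, Rabs_pos_eq; lra. }
  destruct (Hn g0) with (eps := r / 8) as [y0 [Hy0 Hd0]]; [|lra|].
  { replace (L g0 [-] L g0) with ([0] : H) by vector; rewrite norm_0; lra. }
  assert (Nt : Cmod (Cinv (RtoC t)) = / t) by (rewrite Cmod_inv, Cmod_R, Rabs_pos_eq; auto; lra).
  exists (Cinv (RtoC t) [*] (y1 [-] y0)); split.
  + rewrite norm_scal_eq, Nt.
    rewrite minus_scal.
    pose proof (norm_plus_le y1 (Copp (RtoC 1) [*] y0)) as P.
    rewrite norm_scal_eq, Cmod_m1 in P.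
    apply Rle_trans with (/ t * (2 * INR n)).
    * apply Rmult_le_compat_l; [left; apply Rinv_0_lt_compat, Ht|lra].
    * rewrite Et'; unfold Rdiv; lra.
  + replace (L (g [-] Cinv (RtoC t) [*] (y1 [-] y0))) with
      (Cinv (RtoC t) [*] ((L y0 [-] L g0) [-] (L y1 [-] L g1))).
    2: { unfold g1; rewrite (linear_map_minus L HL), (linear_map_scal L HL),
           (linear_map_minus L HL), (linear_map_plus L HL), (linear_map_scal L HL).
         vector; field; exact Ct. }
    rewrite norm_scal_eq, Nt.
    rewrite minus_scal.
    pose proof (norm_plus_le (L y0 [-] L g0) (Copp (RtoC 1) [*] (L y1 [-] L g1))) as P.
    rewrite norm_scal_eq, Cmod_m1 in P.
    apply Rle_trans with (/ t * (r / 4)).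
    * apply Rmult_le_compat_l; [left; apply Rinv_0_lt_compat, Ht|lra].
    * rewrite Et'; right; field; lra.
- exists (RtoC 0 [*] g); rewrite norm_scal_eq, Cmod_0, <- Hg; split; [lra|].
  replace (g [-] RtoC 0 [*] g) with g by vector; lra.
Qed.

(** Repeatedly subtracting approximate preimages from [g] halves the image each time and converges
    to a kernel vector [k] with [norm (g [-] k) <= 2 * C * norm (L g)]. If [g] is orthogonal to the
    kernel, then [norm g <= norm (g [-] k)]. *)
Lemma closed_range_bounded_below {H : HilbertSpace} (L : H -> H) :
  is_linear L -> closed (fun y : H => exists x, y = L x) ->
  exists c, 0 < c /\ forall g,
    (forall k, L k = [0] -> inner g k = RtoC 0) -> c * norm g <= norm (L g).
Proof.
intros HL Hcl.
destruct (closed_range_approximate_preimage L HL Hcl) as [C [HC Hpre]].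
pose (F := fun g => proj1_sig (constructive_indefinite_description _ (Hpre g))).
assert (HF : forall g, norm (F g) <= C * norm (L g) /\
    norm (L (g [-] F g)) <= / 2 * norm (L g)).
{ intro g; unfold F; exact (proj2_sig (constructive_indefinite_description _ (Hpre g))). }
assert (Hinv : 0 < / (2 * C)) by (apply Rinv_0_lt_compat; lra).
exists (/ (2 * C)); split; [exact Hinv|].
intros g Hg.
pose (u := nat_rect (fun _ => H : Type) g (fun _ v => v [-] F v)).
assert (Hu : forall n, u (S n) = u n [-] F (u n)) by reflexivity.
assert (HLu : forall n, norm (L (u n)) <= norm (L g) * (/ 2) ^ n).
{ induction n as [|n IH]; [simpl; lra|].
  rewrite Hu; destruct (HF (u n)) as [_ P]; simpl pow; lra. }
destruct (geometric_steps_converge u (C * norm (L g))) as [k Hk].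
{ intro n; rewrite Hu, norm_minus_sym.
  replace (u n [-] (u n [-] F (u n))) with (F (u n)) by vector.
  destruct (HF (u n)) as [P _]; specialize (HLu n).
  apply (Rmult_le_compat_l C) in HLu; lra. }
destruct (linear_norm L HL) as [M [HM HMn]].
assert (Lk : L k = [0]).
{ apply norm_eq_0; apply Rle_antisym; [|apply norm_ge_0].
  apply le_epsilon; intros eps Heps; rewrite Rplus_0_l.
  destruct (geometric_small (M * (2 * (C * norm (L g))) + norm (L g)) eps Heps) as [N HN].
  specialize (HN N ltac:(lia)); specialize (HMn (k [-] u N)).
  rewrite linear_map_minus in HMn by assumption.
  specialize (Hk N); apply (Rmult_le_compat_l M) in Hk; [|lra].
  pose proof (norm_plus_le (L k [-] L (u N)) (L (u N))) as P.
  replace (L k [-] L (u N) [+] L (u N)) with (L k) in P by vector.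
  specialize (HLu N); lra. }
specialize (Hk O); simpl in Hk; rewrite norm_minus_sym in Hk.
specialize (Hg k Lk).
assert (E : norm g ^ 2 <= norm g * norm (g [-] k)).
{ rewrite norm_sqr.
  replace (inner g g) with (inner g (g [-] k)) by (rewrite inner_minus_r, Hg; ring).
  apply Re_inner_le. }
pose proof (norm_ge_0 (L g)).
destruct (norm_ge_0 g) as [Pg|Pg].
- assert (Q : norm g <= norm (g [-] k)) by (apply Rmult_le_reg_l with (norm g); lra).
  apply Rmult_le_reg_l with (2 * C); [lra|].
  rewrite <- Rmult_assoc, Rinv_r by lra; lra.
- rewrite <- Pg; lra.
Qed.

(** * Holomorphic frames and curvature *)

Lemma Cmod_sym (u v : C) : Cmod (Cminus u v) = Cmod (Cminus v u).
Proof. rewrite <- Cmod_opp; f_equal; ring. Qed.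

Lemma linear_map_shift {H : HilbertSpace} (T : H -> H) (w : C) :
  is_linear T -> is_linear (fun x => T x [-] w [*] x).
Proof.
intro HT; split.
- intros x y; change (T (x [+] y) [-] w [*] (x [+] y) = (T x [-] w [*] x) [+] (T y [-] w [*] y)).
  rewrite (linear_map_plus T HT); vector.
- intros c x; change (T (c [*] x) [-] w [*] (c [*] x) = c [*] (T x [-] w [*] x)).
  rewrite (linear_map_scal T HT); vector.
- destruct (linear_norm T HT) as [M [HM Hn]].
  pose proof (Cmod_ge_0 w); exists (M + Cmod w); split; [lra|]; intro x.
  rewrite minus_scal.
  pose proof (norm_plus_le (T x) (Copp (RtoC 1) [*] (w [*] x))) as P.
  rewrite !norm_scal_eq, Cmod_m1 in P; specialize (Hn x); lra.
Qed.

(** At [v = z] the kernel is spanned by [x], so the closed range gives a bound [c] on its orthogonal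
    complement. Moving [v] by less than [c / 2] costs at most half of it, and the complement does
    not move with [v]. *)
Lemma bounded_below_near_eigenvector {H : HilbertSpace} (T : H -> H) (z : C) :
  cowen_douglas_B1 T -> unit_disc z ->
  exists (x : H) (b r : R), norm x = 1 /\ eigenspace T z x /\ 0 < b /\ 0 < r /\
    forall v, Cmod (Cminus v z) < r -> unit_disc v /\
      forall y, inner y x = RtoC 0 -> b * norm y <= norm (T y [-] v [*] y).
Proof.
intros HB Hz; pose proof (B1_bounded T HB) as HT.
destruct (B1_kernel T HB z Hz) as [e [He Hk]].
pose proof (norm_gt_0 e He) as Ne.
destruct (closed_range_bounded_below _ (linear_map_shift T z HT) (B1_closed_range T HB z Hz))
  as [c [Hc Hb]].
assert (Hx : Cmod (Cinv (RtoC (norm e))) = / norm e).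
{ rewrite Cmod_inv, Cmod_R, Rabs_pos_eq; [reflexivity|lra|].
  intro E; apply RtoC_inj in E; lra. }
exists (Cinv (RtoC (norm e)) [*] e), (c / 2), (Rmin (c / 2) (1 - Cmod z)).
assert (Hz' := Hz); unfold unit_disc in Hz'.
split; [rewrite norm_scal_eq, Hx; field; lra|].
split; [apply Hk; exists (Cinv (RtoC (norm e))); reflexivity|].
split; [lra|]; split; [apply Rmin_pos; lra|].
intros v Hv.
pose proof (Rmin_l (c / 2) (1 - Cmod z)); pose proof (Rmin_r (c / 2) (1 - Cmod z)).
split.
- unfold unit_disc; pose proof (Cmod_triangle (Cminus v z) z) as P.
  replace (Cplus (Cminus v z) z) with v in P by ring; lra.
- intros y Hy.
  assert (Q : c * norm y <= norm (T y [-] z [*] y)).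
  { apply Hb; intros k Lk.
    assert (Ek : eigenspace T z k).
    { unfold eigenspace; change (T k = z [*] k).
      replace (T k) with ((T k [-] z [*] k) [+] z [*] k) by vector.
      rewrite Lk; vector. }
    apply Hk in Ek; destruct Ek as [a Ea]; change (k = a [*] e) in Ea.
    assert (Hye : inner y e = RtoC 0).
    { apply Cmod_eq_0; apply (f_equal Cmod) in Hy.
      rewrite inner_scal_r, Cmod_mult, Cmod_conj, Hx, Cmod_0 in Hy.
      apply Rmult_eq_reg_l with (/ norm e); [lra|apply Rinv_neq_0_compat; lra]. }
    rewrite Ea, inner_scal_r, Hye; ring. }
  pose proof (norm_plus_le (T y [-] v [*] y) (Cminus v z [*] y)) as P.
  replace (T y [-] v [*] y [+] Cminus v z [*] y) with (T y [-] z [*] y) in P by vector.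
  rewrite norm_scal_eq in P; pose proof (norm_ge_0 y).
  assert (Cmod (Cminus v z) * norm y <= c / 2 * norm y)
    by (apply Rmult_le_compat_r; lra).
  lra.
Qed.

(** [gamma] is a holomorphic frame with [<gamma v, gamma z> = 1] and derivative [y].
    Normalizing against the fixed vector [gamma z] makes both differences
    [gamma v' - gamma v] and [y v] orthogonal to it, where [T - v] is uniformly
    bounded below; this gives explicit Lipschitz bounds in place of Cauchy's
    estimates. *)
Lemma normalized_frame {H : HilbertSpace} (T : H -> H) (z : C) :
  cowen_douglas_B1 T -> unit_disc z ->
  exists (gamma y : C -> H) (r K : R), 0 < r /\ 0 < K /\ norm (gamma z) = 1 /\
    forall v, Cmod (Cminus v z) < r ->
      eigenspace T v (gamma v) /\
      inner (gamma v) (gamma z) = RtoC 1 /\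
      inner (y v) (gamma z) = RtoC 0 /\
      T (y v) = v [*] y v [+] gamma v /\
      norm (y v [-] y z) <= K * Cmod (Cminus v z) /\
      forall v', Cmod (Cminus v' z) < r ->
        norm (gamma v' [-] gamma v [-] Cminus v' v [*] y v) <= K * Cmod (Cminus v' v) ^ 2.
Proof.
intros HB Hz; pose proof (B1_bounded T HB) as HT.
destruct (bounded_below_near_eigenvector T z HB Hz) as [x [b [r [Hx [Ex [Hb [Hr Hv]]]]]]].
assert (Z0 : Cmod (Cminus z z) < r)
  by (replace (Cminus z z) with (RtoC 0) by ring; rewrite Cmod_0; lra).
assert (Exx : inner x x = RtoC 1) by (rewrite inner_norm, Hx; f_equal; ring).
(* The guard lets choice produce a total function, with default [[0]] away from [z]. *)
assert (Hg : forall v, exists g, Cmod (Cminus v z) < r ->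
  eigenspace T v g /\ inner g x = RtoC 1).
{ intro v; destruct (Rlt_le_dec (Cmod (Cminus v z)) r) as [Lv|Lv];
    [|exists [0]; intro; lra].
  destruct (Hv v Lv) as [Dv Bv]; destruct (B1_kernel T HB v Dv) as [e [He Hk]].
  assert (Ee : T e = v [*] e) by (apply Hk; exists (RtoC 1); vector).
  (* Otherwise the lower bound would apply to [e], which [T - v] annihilates. *)
  assert (Ne : inner e x <> RtoC 0).
  { intro E; specialize (Bv e E); rewrite Ee in Bv.
    replace (v [*] e [-] v [*] e) with (RtoC 0 [*] e) in Bv by vector.
    rewrite norm_scal_eq, Cmod_0 in Bv; pose proof (norm_gt_0 e He).
    assert (0 < b * norm e) by (apply Rmult_lt_0_compat; lra); lra. }
  exists (Cinv (inner e x) [*] e); intros _; split.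
  - apply Hk; eexists; reflexivity.
  - rewrite inner_scal_l, Cinv_l; [reflexivity|exact Ne]. }
pose (gamma := fun v => proj1_sig (constructive_indefinite_description _ (Hg v))).
assert (Hgamma : forall v, Cmod (Cminus v z) < r ->
  T (gamma v) = v [*] gamma v /\ inner (gamma v) x = RtoC 1).
{ intro v; unfold gamma.
  exact (proj2_sig (constructive_indefinite_description _ (Hg v))). }
(* The chosen [gamma z] differs from [x] by an eigenvector orthogonal to [x], and the lower bound
   makes that vanish. *)
assert (Gx : gamma z = x).
{ destruct (Hgamma z Z0) as [E1 E2]; destruct (Hv z Z0) as [_ B].
  specialize (B (gamma z [-] x)).
  rewrite inner_minus_l, E2, Exx in B; specialize (B ltac:(ring)).
  rewrite (linear_map_minus T HT), E1, Ex in B.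
  replace (z [*] gamma z [-] z [*] x [-] z [*] (gamma z [-] x)) with (RtoC 0 [*] x) in B by vector.
  rewrite norm_scal_eq, Cmod_0, Rmult_0_l in B.
  pose proof (norm_ge_0 (gamma z [-] x)).
  assert (N : gamma z [-] x = [0]) by (apply norm_eq_0; nra).
  replace (gamma z) with ((gamma z [-] x) [+] x) by vector; rewrite N; vector. }
set (G := 1 + r / b).
assert (Hrb : 0 < r / b) by (apply Rdiv_lt_0_compat; lra).
assert (Dx : forall v, Cmod (Cminus v z) < r -> b * norm (gamma v [-] x) <= Cmod (Cminus v z)).
{ intros v Lv; destruct (Hgamma v Lv) as [E1 E2]; destruct (Hv v Lv) as [_ B].
  specialize (B (gamma v [-] x)).
  rewrite inner_minus_l, E2, Exx in B; specialize (B ltac:(ring)).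
  rewrite (linear_map_minus T HT), E1, Ex in B.
  change (scal z x) with (z [*] x) in B.
  replace (v [*] gamma v [-] z [*] x [-] v [*] (gamma v [-] x))
    with (Cminus v z [*] x) in B by vector.
  rewrite norm_scal_eq, Hx in B; lra. }
assert (Bg : forall v, Cmod (Cminus v z) < r -> norm (gamma v) <= G).
{ intros v Lv; specialize (Dx v Lv); pose proof (norm_plus_le (gamma v [-] x) x) as P.
  replace (gamma v [-] x [+] x) with (gamma v) in P by vector.
  assert (norm (gamma v [-] x) <= r / b)
    by (apply Rmult_le_reg_l with b; [lra|]; replace (b * (r / b)) with r by (field; lra); lra).
  unfold G; lra. }
assert (HG : 0 < G) by (unfold G; lra).
assert (Lip : forall v v', Cmod (Cminus v z) < r -> Cmod (Cminus v' z) < r ->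
  norm (gamma v' [-] gamma v) <= G / b * Cmod (Cminus v' v)).
{ intros v v' Lv Lv'; destruct (Hgamma v Lv) as [E1 E2]; destruct (Hgamma v' Lv') as [E1' E2'].
  destruct (Hv v Lv) as [_ B]; specialize (B (gamma v' [-] gamma v)).
  rewrite inner_minus_l, E2, E2' in B; specialize (B ltac:(ring)).
  rewrite (linear_map_minus T HT), E1, E1' in B.
  replace (v' [*] gamma v' [-] v [*] gamma v [-] v [*] (gamma v' [-] gamma v))
    with (Cminus v' v [*] gamma v') in B by vector.
  rewrite norm_scal_eq in B; specialize (Bg v' Lv'); pose proof (Cmod_ge_0 (Cminus v' v)).
  apply Rmult_le_reg_l with b; [lra|].
  replace (b * (G / b * Cmod (Cminus v' v))) with (Cmod (Cminus v' v) * G) by (field; lra).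
  apply Rle_trans with (1 := B), Rmult_le_compat_l; lra. }
assert (Hy : forall v, exists y, Cmod (Cminus v z) < r ->
  T y = v [*] y [+] gamma v /\ inner y x = RtoC 0).
{ intro v; destruct (Rlt_le_dec (Cmod (Cminus v z)) r) as [Lv|Lv];
    [|exists [0]; intro; lra].
  destruct (Hv v Lv) as [Dv _]; destruct (Hgamma v Lv) as [E1 E2].
  (* The derivative must solve [(T - v) y = gamma v]. For [v' = v + t] the vector [gamma v'] is the
     image under [T - v] of [gamma v' / t], and it tends to [gamma v]; closedness of the range gives
     a solution. *)
  destruct (closed_limit _ (gamma v) (B1_closed_range T HB v Dv)) as [y0 Hy0].
  { intros eps Heps.
    set (t := Rmin ((r - Cmod (Cminus v z)) / 2) (eps / (G / b) / 2)).
    assert (HGb : 0 < G / b) by (apply Rdiv_lt_0_compat; lra).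
    assert (Heb : 0 < eps / (G / b)) by (apply Rdiv_lt_0_compat; lra).
    assert (Ht : 0 < t) by (apply Rmin_pos; lra).
    assert (Ht1 : t <= (r - Cmod (Cminus v z)) / 2) by apply Rmin_l.
    assert (Ht2 : t <= eps / (G / b) / 2) by apply Rmin_r.
    assert (Ct : RtoC t <> RtoC 0) by (intro E; apply RtoC_inj in E; lra).
    set (v' := Cplus v (RtoC t)).
    assert (Evv : Cminus v' v = RtoC t) by (unfold v'; ring).
    assert (Lv' : Cmod (Cminus v' z) < r).
    { replace (Cminus v' z) with (Cplus (Cminus v z) (RtoC t)) by (unfold v'; ring).
      pose proof (Cmod_triangle (Cminus v z) (RtoC t)) as P.
      rewrite Cmod_R, Rabs_pos_eq in P; lra. }
    exists (gamma v'); split.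
    - destruct (Hgamma v' Lv') as [E1' _].
      exists (Cinv (RtoC t) [*] gamma v').
      change (gamma v' = T (Cinv (RtoC t) [*] gamma v') [-] v [*] (Cinv (RtoC t) [*] gamma v')).
      rewrite (linear_map_scal T HT), E1'; unfold v' at 2; vector; field; exact Ct.
    - apply Rle_lt_trans with (1 := Lip v v' Lv Lv'); rewrite Evv, Cmod_R, Rabs_pos_eq by lra.
      apply Rle_lt_trans with (G / b * (eps / (G / b) / 2)).
      + apply Rmult_le_compat_l; lra.
      + replace (G / b * (eps / (G / b) / 2)) with (eps / 2) by (field; lra); lra. }
  change (gamma v = T y0 [-] v [*] y0) in Hy0.
  (* A multiple of [gamma v] lies in the kernel of [T - v], so it can be used to make the solution
     orthogonal to [x]. *)
  exists (y0 [-] inner y0 x [*] gamma v); intros _; split.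
  - rewrite (linear_map_minus T HT), (linear_map_scal T HT), E1.
    replace (T y0) with (gamma v [+] v [*] y0) by (rewrite Hy0; vector); vector.
  - rewrite inner_minus_l, inner_scal_l, E2; ring. }
pose (y := fun v => proj1_sig (constructive_indefinite_description _ (Hy v))).
assert (Hyv : forall v, Cmod (Cminus v z) < r ->
  T (y v) = v [*] y v [+] gamma v /\ inner (y v) x = RtoC 0).
{ intro v; unfold y.
  exact (proj2_sig (constructive_indefinite_description _ (Hy v))). }
(* The Lipschitz bound for [y] collects two terms [G / b / b], one from the change of [v] and one
   from the change of [gamma v]; the Taylor remainder needs one. *)
set (K := G / b / b + G / b / b).
assert (HK : 0 < G / b / b) by (repeat apply Rdiv_lt_0_compat; lra).
exists gamma, y, r, K; split; [exact Hr|]; split; [unfold K; lra|].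
rewrite Gx; split; [exact Hx|].
intros v Lv; destruct (Hgamma v Lv) as [E1 E2]; destruct (Hyv v Lv) as [Y1 Y2].
split; [exact E1|]; split; [exact E2|]; split; [exact Y2|]; split; [exact Y1|].
destruct (Hv v Lv) as [_ B]; split.
- destruct (Hyv z Z0) as [Z1 Z2].
  assert (By : norm (y v) <= G / b).
  { specialize (B (y v) Y2); rewrite Y1 in B.
    replace (v [*] y v [+] gamma v [-] v [*] y v) with (gamma v) in B by vector.
    specialize (Bg v Lv); apply Rmult_le_reg_l with b; [lra|].
    replace (b * (G / b)) with G by (field; lra); lra. }
  destruct (Hv z Z0) as [_ Bz]; specialize (Bz (y v [-] y z)).
  rewrite inner_minus_l, Y2, Z2 in Bz; specialize (Bz ltac:(ring)).
  rewrite (linear_map_minus T HT), Y1, Z1 in Bz.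
  replace (v [*] y v [+] gamma v [-] (z [*] y z [+] gamma z) [-] z [*] (y v [-] y z))
    with (Cminus v z [*] y v [+] (gamma v [-] gamma z)) in Bz by vector.
  pose proof (norm_plus_le (Cminus v z [*] y v) (gamma v [-] gamma z)) as P.
  rewrite norm_scal_eq in P; specialize (Lip z v Z0 Lv).
  pose proof (Cmod_ge_0 (Cminus v z)).
  assert (Cmod (Cminus v z) * norm (y v) <= Cmod (Cminus v z) * (G / b))
    by (apply Rmult_le_compat_l; lra).
  apply Rmult_le_reg_l with b; [lra|].
  replace (b * (K * Cmod (Cminus v z))) with (2 * (G / b * Cmod (Cminus v z)))
    by (unfold K; field; lra); lra.
(* [T - v] maps the Taylor remainder to [(v' - v)] times [gamma v' [-] gamma v], which is already
   quadratic by [Lip]. *)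
- intros v' Lv'; destruct (Hgamma v' Lv') as [E1' E2'].
  specialize (B (gamma v' [-] gamma v [-] Cminus v' v [*] y v)).
  rewrite !inner_minus_l, inner_scal_l, E2, E2', Y2 in B; specialize (B ltac:(ring)).
  rewrite !(linear_map_minus T HT), (linear_map_scal T HT), E1, E1', Y1 in B.
  replace (v' [*] gamma v' [-] v [*] gamma v [-] Cminus v' v [*] (v [*] y v [+] gamma v)
      [-] v [*] (gamma v' [-] gamma v [-] Cminus v' v [*] y v))
    with (Cminus v' v [*] (gamma v' [-] gamma v)) in B by vector.
  rewrite norm_scal_eq in B; specialize (Lip v v' Lv Lv').
  pose proof (Cmod_ge_0 (Cminus v' v)).
  assert (Cmod (Cminus v' v) * norm (gamma v' [-] gamma v)
      <= Cmod (Cminus v' v) * (G / b * Cmod (Cminus v' v))) by (apply Rmult_le_compat_l; lra).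
  apply Rle_trans with (G / b / b * Cmod (Cminus v' v) ^ 2).
  + apply Rmult_le_reg_l with b; [lra|].
    replace (b * (G / b / b * Cmod (Cminus v' v) ^ 2))
      with (Cmod (Cminus v' v) * (G / b * Cmod (Cminus v' v))) by (field; lra); lra.
  + pose proof (pow2_ge_0 (Cmod (Cminus v' v))).
    apply Rmult_le_compat_r; [assumption|unfold K; lra].
Qed.

(** * Real and Wirtinger derivatives from quadratic remainders *)

Lemma is_derive_quadratic (f : R -> R) (l K delta : R) : 0 < delta ->
  (forall t, Rabs t < delta -> Rabs (f t - f 0 - t * l) <= K * t ^ 2) ->
  is_derive f 0 l.
Proof.
intros Hd Hf; apply is_derive_Reals; intros eps Heps.
assert (HK : 0 < Rabs K + 1) by (pose proof (Rabs_pos K); lra).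
assert (Hm : 0 < Rmin delta (eps / (Rabs K + 1)))
  by (apply Rmin_pos; [lra|apply Rdiv_lt_0_compat; lra]).
exists (mkposreal _ Hm); intros h Hh Hlt; simpl in Hlt; rewrite Rplus_0_l.
pose proof (Rmin_l delta (eps / (Rabs K + 1))); pose proof (Rmin_r delta (eps / (Rabs K + 1))).
specialize (Hf h ltac:(lra)).
assert (Ph : 0 < Rabs h) by (apply Rabs_pos_lt, Hh).
replace ((f h - f 0) / h - l) with ((f h - f 0 - h * l) / h) by (field; exact Hh).
unfold Rdiv; rewrite Rabs_mult, Rabs_inv.
apply Rmult_lt_reg_r with (Rabs h); [exact Ph|].
rewrite Rmult_assoc, Rinv_l, Rmult_1_r by lra.
apply Rle_lt_trans with (1 := Hf).
rewrite <- (pow2_abs h); pose proof (Rle_abs K).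
apply Rle_lt_trans with (Rabs K * Rabs h * Rabs h).
{ assert (K * Rabs h <= Rabs K * Rabs h) by (apply Rmult_le_compat_r; lra).
  assert (K * Rabs h * Rabs h <= Rabs K * Rabs h * Rabs h) by (apply Rmult_le_compat_r; lra).
  simpl; lra. }
apply Rmult_lt_compat_r; [exact Ph|].
assert (Rabs h * (Rabs K + 1) < eps).
{ replace eps with (eps / (Rabs K + 1) * (Rabs K + 1)) by (field; lra).
  apply Rmult_lt_compat_r; lra. }
lra.
Qed.

Lemma is_derive_norm_sqr {H : HilbertSpace} (g : R -> H) (y : H) (K delta : R) :
  0 < delta -> 0 <= K ->
  (forall t, Rabs t < delta -> norm (g t [-] g 0 [-] RtoC t [*] y) <= K * t ^ 2) ->
  is_derive (fun t => norm (g t) ^ 2) 0 (2 * Re (inner y (g 0))).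
Proof.
intros Hd HK Hg.
apply is_derive_quadratic with (2 * norm (g 0) * K + (K * delta + norm y) ^ 2) delta;
  [exact Hd|]; intros t Ht; specialize (Hg t Ht).
set (rho := g t [-] g 0 [-] RtoC t [*] y) in *.
set (w := rho [+] RtoC t [*] y).
assert (E : g t = w [+] g 0) by (unfold w, rho; vector).
rewrite E, norm_sqr_plus; unfold w at 2; rewrite inner_plus_l, inner_scal_l.
replace (norm w ^ 2 + 2 * Re (inner rho (g 0) + t * inner y (g 0)) + norm (g 0) ^ 2 -
   norm (g 0) ^ 2 - t * (2 * Re (inner y (g 0))))
  with (norm w ^ 2 + 2 * Re (inner rho (g 0))) by (unfold Re; simpl; ring).
assert (Nw : norm w <= (K * delta + norm y) * Rabs t).
{ unfold w; pose proof (norm_plus_le rho (RtoC t [*] y)) as P.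
  rewrite norm_scal_eq, Cmod_R in P.
  rewrite <- (pow2_abs t) in Hg.
  assert (K * (Rabs t * Rabs t) <= K * (delta * Rabs t))
    by (apply Rmult_le_compat_l, Rmult_le_compat_r; try apply Rabs_pos; lra).
  simpl in Hg; lra. }
assert (Nw2 : norm w ^ 2 <= (K * delta + norm y) ^ 2 * t ^ 2).
{ rewrite <- (pow2_abs t), <- Rpow_mult_distr; apply pow_incr; split; [apply norm_ge_0|lra]. }
pose proof (Rle_trans _ _ _ (re_le_Cmod _) (Cauchy_Schwarz rho (g 0))) as P.
pose proof (norm_ge_0 (g 0)).
assert (norm rho * norm (g 0) <= K * t ^ 2 * norm (g 0)) by (apply Rmult_le_compat_r; lra).
refine (Rle_trans _ _ _ (Rabs_triang _ _) _).
rewrite Rabs_pos_eq by apply pow2_ge_0.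
rewrite Rabs_mult, Rabs_pos_eq by lra; lra.
Qed.

Lemma is_derive_ln_norm_sqr {H : HilbertSpace} (gamma : C -> H) (v d : C) (y : H) (K r : R) :
  0 < r -> 0 <= K -> Cmod d = 1 -> gamma v <> [0] ->
  (forall v', Cmod (Cminus v' v) < r ->
     norm (gamma v' [-] gamma v [-] Cminus v' v [*] y) <= K * Cmod (Cminus v' v) ^ 2) ->
  is_derive (fun t => ln (norm (gamma (Cplus v (Cmult d (RtoC t)))) ^ 2)) 0
    (2 * Re (Cmult d (inner y (gamma v))) / norm (gamma v) ^ 2).
Proof.
intros Hr HK Hd Hv Hg.
assert (E0 : Cplus v (Cmult d (RtoC 0)) = v) by ring.
assert (D : is_derive (fun t => norm (gamma (Cplus v (Cmult d (RtoC t)))) ^ 2) 0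
    (2 * Re (Cmult d (inner y (gamma v))))).
{ rewrite <- inner_scal_l.
  replace (gamma v) with (gamma (Cplus v (Cmult d (RtoC 0)))) by (rewrite E0; reflexivity).
  apply (is_derive_norm_sqr (fun t => gamma (Cplus v (Cmult d (RtoC t)))) (d [*] y) K r);
    [exact Hr|exact HK|].
  intros t Ht; rewrite E0.
  specialize (Hg (Cplus v (Cmult d (RtoC t)))).
  replace (Cminus (Cplus v (Cmult d (RtoC t))) v) with (Cmult d (RtoC t)) in Hg by ring.
  rewrite Cmod_mult, Hd, Cmod_R, Rmult_1_l, pow2_abs in Hg.
  replace (RtoC t [*] (d [*] y)) with (Cmult d (RtoC t) [*] y) by vector; auto. }
pose proof (norm_gt_0 _ Hv) as Hv0.
assert (Hp : 0 < norm (gamma v) ^ 2) by (apply pow_lt; exact Hv0).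
replace (2 * Re (d * inner y (gamma v)) / norm (gamma v) ^ 2) with
  (scal (2 * Re (Cmult d (inner y (gamma v)))) (/ norm (gamma v) ^ 2)) by reflexivity.
apply (is_derive_comp ln (fun t => norm (gamma (Cplus v (Cmult d (RtoC t)))) ^ 2)).
- rewrite E0; apply is_derive_ln; exact Hp.
- exact D.
Qed.

(** With [a = inner y (gamma v)], the directional derivatives along [1] and [Ci] involve [Re a] and
    [Re (Ci a)], and [Re a + Ci Re (Ci a)] is the conjugate of [a]: the derivative falls on the
    conjugate-linear slot. *)
Lemma d_wbar_ln_norm_sqr {H : HilbertSpace} (gamma : C -> H) (v : C) (y : H) (K r : R) :
  0 < r -> 0 <= K -> gamma v <> [0] ->
  (forall v', Cmod (Cminus v' v) < r ->
     norm (gamma v' [-] gamma v [-] Cminus v' v [*] y) <= K * Cmod (Cminus v' v) ^ 2) ->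
  d_wbar (fun v => RtoC (ln (norm (gamma v) ^ 2))) v =
  Cdiv (inner (gamma v) y) (RtoC (norm (gamma v) ^ 2)).
Proof.
intros Hr HK Hv Hg.
pose proof (is_derive_ln_norm_sqr gamma v (RtoC 1) y K r Hr HK Cmod_1 Hv Hg) as D1.
pose proof (is_derive_ln_norm_sqr gamma v Ci y K r Hr HK Cmod_Ci Hv Hg) as Di.
apply is_derive_unique in D1; apply is_derive_unique in Di.
assert (Np : norm (gamma v) ^ 2 <> 0) by (apply pow_nonzero; pose proof (norm_gt_0 _ Hv); lra).
assert (E1 : d_x (fun v => RtoC (ln (norm (gamma v) ^ 2))) v =
  (2 * Re (Cmult (RtoC 1) (inner y (gamma v))) / norm (gamma v) ^ 2, 0)).
{ unfold d_x; f_equal.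
  - rewrite <- D1; apply Derive_ext; intro t.
    rewrite Cmult_1_l; reflexivity.
  - unfold Im; simpl; apply Derive_const. }
assert (Ei : d_y (fun v => RtoC (ln (norm (gamma v) ^ 2))) v =
  (2 * Re (Cmult Ci (inner y (gamma v))) / norm (gamma v) ^ 2, 0)).
{ unfold d_y; f_equal.
  - rewrite <- Di; apply Derive_ext; intro t; reflexivity.
  - unfold Im; simpl; apply Derive_const. }
unfold d_wbar; rewrite E1, Ei, (inner_conj H y (gamma v)).
generalize (norm (gamma v) ^ 2) Np; clear; intros n Np.
destruct (inner y (gamma v)) as [a b].
unfold Cdiv; rewrite <- !RtoC_inv by first [exact Np | lra].
unfold Re, Cconj, Ci, RtoC, Cmult, Cplus; simpl; f_equal; field; exact Np.
Qed.

(** The remainder leaves no room for a term in the conjugate of [h], so [f] is complex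
    differentiable at the point [z]: the partial derivatives are [q] and [Ci q]. *)
Lemma d_w_quadratic (f : C -> C) (z q : C) (K delta : R) : 0 < delta ->
  (forall h, Cmod h < delta ->
     Cmod (Cminus (Cminus (f (Cplus z h)) (f z)) (Cmult h q)) <= K * Cmod h ^ 2) ->
  d_w f z = q.
Proof.
intros Hd Hf.
assert (D : forall d, Cmod d = 1 ->
  Derive (fun t => Re (f (Cplus z (Cmult d (RtoC t))))) 0 = Re (Cmult d q) /\
  Derive (fun t => Im (f (Cplus z (Cmult d (RtoC t))))) 0 = Im (Cmult d q)).
{ intros d Ed.
  assert (Q : forall t, Rabs t < delta ->
    Cmod (Cminus (Cminus (f (Cplus z (Cmult d (RtoC t)))) (f (Cplus z (Cmult d (RtoC 0)))))
       (Cmult (RtoC t) (Cmult d q))) <= K * t ^ 2).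
  { intros t Ht; specialize (Hf (Cmult d (RtoC t))).
    rewrite Cmod_mult, Ed, Cmod_R, Rmult_1_l, pow2_abs in Hf; specialize (Hf Ht).
    replace (Cplus z (Cmult d (RtoC 0))) with z by ring.
    replace (Cmult (RtoC t) (Cmult d q)) with (Cmult (Cmult d (RtoC t)) q) by ring.
    exact Hf. }
  split; apply is_derive_unique, is_derive_quadratic with K delta; try exact Hd;
    intros t Ht; refine (Rle_trans _ _ _ _ (Q t Ht)).
  - refine (Rle_trans _ _ _ _ (re_le_Cmod _)); right; f_equal.
    unfold Re, Cminus, Cplus, Copp, Cmult, RtoC; simpl; ring.
  - refine (Rle_trans _ _ _ _ (Rmax_Cmod _)).
    refine (Rle_trans _ _ _ _ (Rmax_r _ _)); right; f_equal.
    unfold Im, Cminus, Cplus, Copp, Cmult, RtoC; simpl; ring. }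
destruct (D (RtoC 1) Cmod_1) as [R1 I1]; destruct (D Ci Cmod_Ci) as [Ri Ii].
assert (Ex : d_x f z = q).
{ unfold d_x; replace q with (Re (Cmult (RtoC 1) q), Im (Cmult (RtoC 1) q)).
  - rewrite <- R1, <- I1; f_equal; apply Derive_ext; intro t;
    rewrite Cmult_1_l; reflexivity.
  - destruct q as [a b]; unfold Re, Im; simpl; f_equal; ring. }
assert (Ey : d_y f z = Cmult Ci q).
{ unfold d_y; rewrite Ri, Ii; destruct (Cmult Ci q); reflexivity. }
unfold d_w; rewrite Ex, Ey; destruct q as [a b].
unfold Cdiv; rewrite <- RtoC_inv by lra.
unfold Ci, RtoC, Cmult, Cminus, Cplus, Copp; simpl; f_equal; field.
Qed.

Lemma locally_Cmod (z : C) (P : C -> Prop) (r : R) : 0 < r ->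
  (forall v, Cmod (Cminus v z) < r -> P v) -> locally z P.
Proof.
(* Halving the radius absorbs the factor [sqrt 2] between coordinate balls and [Cmod]. *)
intros Hr HP; assert (Hr2 : 0 < r / 2) by lra.
exists (mkposreal _ Hr2); intros v Hv; apply HP.
apply C_NormedModule_mixin_compat2 in Hv; simpl in Hv.
apply Rlt_le_trans with (1 := Hv).
assert (sqrt 2 <= 2).
{ rewrite <- (sqrt_pow2 2) at 2 by lra; apply sqrt_le_1; lra. }
assert (sqrt 2 * (r / 2) <= 2 * (r / 2)) by (apply Rmult_le_compat_r; lra); lra.
Qed.

Lemma is_derive_C_quadratic {H : HilbertSpace} (f : C -> H) (z : C) (l : H) (K r : R) :
  0 < r -> 0 <= K ->
  (forall v, Cmod (Cminus v z) < r ->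
     norm (f v [-] f z [-] Cminus v z [*] l) <= K * Cmod (Cminus v z) ^ 2) ->
  @is_derive C_AbsRing H f z l.
Proof.
intros Hr HK Hf; split.
- apply (is_linear_scal_l (K := C_AbsRing) (V := H) l).
- intros x Hx.
  assert (E : z = x).
  { apply (is_filter_lim_locally_unique (V := AbsRing_NormedModule C_AbsRing) z x Hx). }
  subst x; intros eps; apply (proj1 (locally_C _ _)).
  pose proof (cond_pos eps) as He.
  assert (Hm : 0 < Rmin r (eps / (K + 1))) by (apply Rmin_pos; [lra|apply Rdiv_lt_0_compat; lra]).
  apply locally_Cmod with (1 := Hm); intros v Hv.
  pose proof (Rmin_l r (eps / (K + 1))); pose proof (Rmin_r r (eps / (K + 1))).
  change (norm (f v [-] f z [-] Cminus v z [*] l) <= eps * Cmod (Cminus v z)).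
  pose proof (Cmod_ge_0 (Cminus v z)).
  apply Rle_trans with (1 := Hf v ltac:(lra)).
  assert (K * Cmod (Cminus v z) <= eps).
  { apply Rle_trans with ((K + 1) * (eps / (K + 1))).
    - apply Rmult_le_compat; lra.
    - right; field; lra. }
  assert (K * Cmod (Cminus v z) * Cmod (Cminus v z) <= eps * Cmod (Cminus v z))
    by (apply Rmult_le_compat_r; lra).
  simpl; lra.
Qed.

(** A product rule: [a] is [h [*] u] up to second order and [c] is [u] up to first order. It is
    applied with [a] the increment of the frame and [c] its derivative. *)
Lemma inner_increment_bound {H : HilbertSpace} (h : C) (u a c : H) (K r : R) :
  0 <= K -> Cmod h <= r ->
  norm (a [-] h [*] u) <= K * Cmod h ^ 2 -> norm (c [-] u) <= K * Cmod h ->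
  Cmod (Cminus (inner a c) (Cmult h (RtoC (norm u ^ 2)))) <=
  (K * (norm u + K * r) + norm u * K) * Cmod h ^ 2.
Proof.
intros HK Hh Ha Hc.
replace (Cminus (inner a c) (Cmult h (RtoC (norm u ^ 2)))) with
  (Cplus (inner (a [-] h [*] u) c) (Cmult h (inner u (c [-] u)))).
2: { rewrite !inner_minus_l, inner_minus_r, inner_scal_l, inner_norm; ring. }
pose proof (Cmod_ge_0 h).
refine (Rle_trans _ _ _ (Cmod_triangle _ _) _); rewrite Cmod_mult.
assert (Nc : norm c <= norm u + K * r).
{ pose proof (norm_plus_le (c [-] u) u) as P.
  replace (c [-] u [+] u) with c in P by vector.
  assert (K * Cmod h <= K * r) by (apply Rmult_le_compat_l; lra); lra. }
pose proof (Cauchy_Schwarz (a [-] h [*] u) c) as P1.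
pose proof (Cauchy_Schwarz u (c [-] u)) as P2.
assert (Q1 : norm (a [-] h [*] u) * norm c <= K * Cmod h ^ 2 * (norm u + K * r))
  by (apply Rmult_le_compat; try apply norm_ge_0; assumption).
assert (Q2 : Cmod h * Cmod (inner u (c [-] u)) <= Cmod h * (norm u * (K * Cmod h))).
{ apply Rmult_le_compat_l; [lra|]; apply Rle_trans with (1 := P2).
  apply Rmult_le_compat_l; [apply norm_ge_0|exact Hc]. }
simpl in *; lra.
Qed.

(** In the normalized frame [d_wbar (ln (norm gamma ^ 2))] equals
    [<gamma v - gamma z, y v> / norm (gamma v) ^ 2], which vanishes at [z] to first
    order with derivative [norm (y z) ^ 2]. *)
Lemma curvature_jet {H : HilbertSpace} (T : H -> H) (z k : C) :
  cowen_douglas_B1 T -> unit_disc z -> has_curvature T z k ->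
  exists x u : H, norm x = 1 /\ T x = z [*] x /\ inner u x = RtoC 0 /\
    T u = z [*] u [+] x /\ k = Copp (RtoC (norm u ^ 2)).
Proof.
intros HB Hz [_ Hk].
destruct (normalized_frame T z HB Hz) as [gamma [y [r [K [Hr [HK [Hx Hv]]]]]]].
assert (Z0 : Cmod (Cminus z z) < r)
  by (replace (Cminus z z) with (RtoC 0) by ring; rewrite Cmod_0; lra).
exists (gamma z), (y z).
destruct (Hv z Z0) as [Z1 [_ [Z2 [Z3 _]]]].
split; [exact Hx|]; split; [exact Z1|]; split; [exact Z2|]; split; [exact Z3|].
assert (Hne : forall v, Cmod (Cminus v z) < r -> gamma v <> [0]).
{ intros v Lv E; destruct (Hv v Lv) as [_ [V2 _]].
  rewrite E, inner_zero_l in V2; apply RtoC_inj in V2; lra. }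
assert (Hloc : forall v, Cmod (Cminus v z) < r -> forall v',
  Cmod (Cminus v' v) < r - Cmod (Cminus v z) ->
  norm (gamma v' [-] gamma v [-] Cminus v' v [*] y v) <= K * Cmod (Cminus v' v) ^ 2).
{ intros v Lv v' Lv'; destruct (Hv v Lv) as [_ [_ [_ [_ [_ V]]]]]; apply V.
  replace (Cminus v' z) with (Cplus (Cminus v' v) (Cminus v z)) by ring.
  pose proof (Cmod_triangle (Cminus v' v) (Cminus v z)); lra. }
rewrite <- (Hk gamma).
2: { apply locally_Cmod with (1 := Hr); intros v Lv.
  split; [|split; [exact (Hne v Lv)|exact (proj1 (Hv v Lv))]].
  exists (y v); apply is_derive_C_quadratic with K (r - Cmod (Cminus v z));
    [lra|lra|exact (Hloc v Lv)]. }
f_equal.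
assert (Hd : forall v, Cmod (Cminus v z) < r ->
  d_wbar (fun v => RtoC (ln (norm (gamma v) ^ 2))) v =
  Cdiv (inner (gamma v [-] gamma z) (y v)) (RtoC (norm (gamma v) ^ 2))).
{ intros v Lv.
  rewrite (d_wbar_ln_norm_sqr gamma v (y v) K (r - Cmod (Cminus v z)));
    [|lra|lra|exact (Hne v Lv)|exact (Hloc v Lv)].
  destruct (Hv v Lv) as [_ [_ [V3 _]]].
  (* Subtracting [gamma z] is free because [y v] is orthogonal to it, and it makes the numerator
     small near [z]. *)
  rewrite inner_minus_l, (inner_conj H (y v) (gamma z)), V3.
  f_equal; unfold Cconj, RtoC, Cminus, Cplus, Copp; simpl.
  destruct (inner (gamma v) (y v)); simpl; f_equal; ring. }
set (u := y z) in *.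
set (A := K * (norm u + K * r) + norm u * K).
set (G := K * r + norm u).
apply d_w_quadratic with (A + r * norm u ^ 2 * G ^ 2) r; [exact Hr|].
intros h Hh.
pose proof (Cmod_ge_0 h).
assert (Ev : Cminus (Cplus z h) z = h) by ring.
assert (Lv : Cmod (Cminus (Cplus z h) z) < r) by (rewrite Ev; exact Hh).
rewrite !Hd by assumption.
replace (gamma z [-] gamma z) with (RtoC 0 [*] gamma z) by vector.
rewrite inner_scal_l.
set (v := Cplus z h) in *.
destruct (Hv v Lv) as [_ [V2 [_ [_ [V5 _]]]]].
destruct (Hv z Z0) as [_ [_ [_ [_ [_ V6]]]]]; specialize (V6 v Lv).
fold u in V6; rewrite Ev in V5, V6.
set (a := gamma v [-] gamma z) in *.
pose proof (inner_increment_bound h u a (y v) K r ltac:(lra) ltac:(lra) V6 V5) as B.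
fold A in B.
assert (Na : norm a <= G * Cmod h).
{ pose proof (norm_plus_le (a [-] h [*] u) (h [*] u)) as P.
  replace (a [-] h [*] u [+] h [*] u) with a in P by vector.
  rewrite norm_scal_eq in P.
  assert (K * Cmod h * Cmod h <= K * r * Cmod h).
  { apply Rmult_le_compat_r; [lra|]; apply Rmult_le_compat_l; lra. }
  unfold G; simpl in V6; lra. }
(* Pythagoras: the increment [a] is orthogonal to the unit vector [gamma z]. The denominator thus
   differs from 1 at second order, and its effect on the quotient is of third order; bounding one
   factor [Cmod h] by [r] gives the constant [r * norm u ^ 2 * G ^ 2]. *)
assert (Nv : norm (gamma v) ^ 2 = 1 + norm a ^ 2).
{ replace (gamma v) with (a [+] gamma z) by (unfold a; vector).
  rewrite norm_sqr_plus, Hx; unfold a at 2.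
  rewrite inner_minus_l, V2, inner_norm, Hx; unfold Re; simpl; ring. }
assert (Na2 : norm a ^ 2 <= G ^ 2 * Cmod h ^ 2).
{ rewrite <- Rpow_mult_distr; apply pow_incr; split; [apply norm_ge_0|exact Na]. }
pose proof (pow2_ge_0 (norm a)) as Pa.
set (N := norm (gamma v) ^ 2) in *.
assert (CN : RtoC N <> RtoC 0) by (intro E; apply RtoC_inj in E; lra).
assert (C1 : RtoC (norm (gamma z) ^ 2) <> RtoC 0)
  by (rewrite Hx; intro E; apply RtoC_inj in E; simpl in E; lra).
replace (Cminus (Cminus (Cdiv (inner a (y v)) (RtoC N))
    (Cdiv (Cmult (RtoC 0) (inner (gamma z) (y z))) (RtoC (norm (gamma z) ^ 2))))
    (Cmult h (RtoC (norm u ^ 2))))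
  with (Cdiv (Cminus (Cminus (inner a (y v)) (Cmult h (RtoC (norm u ^ 2))))
          (Cmult (Cmult h (RtoC (norm u ^ 2))) (RtoC (norm a ^ 2)))) (RtoC N)).
2: { replace (RtoC (norm a ^ 2)) with (Cminus (RtoC N) (RtoC 1))
       by (rewrite Nv, RtoC_plus; ring).
     field; split; assumption. }
rewrite Cmod_div by exact CN.
rewrite Cmod_R, (Rabs_pos_eq N) by lra.
apply Rle_trans with (Cmod (Cminus (Cminus (inner a (y v)) (Cmult h (RtoC (norm u ^ 2))))
          (Cmult (Cmult h (RtoC (norm u ^ 2))) (RtoC (norm a ^ 2))))).
{ apply Rmult_le_reg_r with N; [lra|]; unfold Rdiv; rewrite Rmult_assoc, Rinv_l by lra.
  apply Rmult_le_compat_l; [apply Cmod_ge_0|lra]. }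
unfold Cminus at 1; refine (Rle_trans _ _ _ (Cmod_triangle _ _) _).
rewrite Cmod_opp, !Cmod_mult, !Cmod_R, !Rabs_pos_eq by apply pow2_ge_0.
pose proof (pow2_ge_0 (norm u)).
assert (Cmod h * norm u ^ 2 * norm a ^ 2 <= r * norm u ^ 2 * (G ^ 2 * Cmod h ^ 2)).
{ apply Rmult_le_compat; try assumption.
  - apply Rmult_le_pos; lra.
  - apply Rmult_le_compat_r; lra. }
lra.
Qed.

(** * The extremal case *)

Lemma is_adjoint_sym {H1 H2 : HilbertSpace} (A : H1 -> H2) (B : H2 -> H1) :
  is_adjoint A B -> is_adjoint B A.
Proof. intros E x y; rewrite inner_conj, <- E, <- inner_conj; reflexivity. Qed.

Lemma adjoint_contraction {H : HilbertSpace} (A B : H -> H) : is_adjoint A B ->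
  (forall x, norm (A x) <= norm x) -> forall x, norm (B x) <= norm x.
Proof.
intros E HA x; pose proof (Re_inner_le (A (B x)) x) as P.
rewrite E, <- norm_sqr in P; specialize (HA (B x)).
pose proof (norm_ge_0 x); destruct (norm_ge_0 (B x)) as [Q|Q]; [|lra].
apply Rmult_le_reg_l with (norm (B x)); [exact Q|].
assert (norm (A (B x)) * norm x <= norm (B x) * norm x) by (apply Rmult_le_compat_r; lra).
simpl in P; lra.
Qed.

(** Expanding, [norm (B (A x) [-] x) ^ 2] is [norm (B (A x)) ^ 2 - 2 * norm (A x) ^ 2 + norm x ^ 2],
    at most [norm x ^ 2 - norm (A x) ^ 2]. *)
Lemma contraction_norm_eq {H : HilbertSpace} (A B : H -> H) (x : H) : is_adjoint A B ->
  (forall x, norm (A x) <= norm x) -> norm (A x) = norm x -> B (A x) = x.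
Proof.
intros E HA Ex; pose proof (adjoint_contraction A B E HA (A x)) as HB.
assert (N : norm (B (A x) [-] x) ^ 2 <= 0).
{ rewrite norm_sqr_minus, (is_adjoint_sym A B E (A x) x), <- norm_sqr, Ex.
  assert (norm (B (A x)) ^ 2 <= norm (A x) ^ 2)
    by (apply pow_incr; split; [apply norm_ge_0|exact HB]).
  rewrite Ex in *; lra. }
pose proof (norm_ge_0 (B (A x) [-] x)).
assert (Z : B (A x) [-] x = [0]) by (apply norm_eq_0; nra).
replace (B (A x)) with ((B (A x) [-] x) [+] x) by vector; rewrite Z; vector.
Qed.

Lemma hyper_contraction {H : HilbertSpace} (A As : H -> H) :
  two_hyper_contraction A As -> forall x, norm (A x) <= norm x.
Proof.
intros [_ [E [P _]]] x; destruct (P x) as [_ Q].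
rewrite inner_minus_l, (is_adjoint_sym A As E (A x) x), !inner_norm in Q.
unfold Re in Q; simpl in Q.
apply Rsqr_incr_0_var; [unfold Rsqr; lra|apply norm_ge_0].
Qed.

(** The second positivity condition read on vectors: the second difference of [norm (A^n x) ^ 2] in
    [n] is nonnegative. *)
Lemma hyper_contraction_convex {H : HilbertSpace} (A As : H -> H) :
  two_hyper_contraction A As ->
  forall x, 2 * norm (A x) ^ 2 <= norm (A (A x)) ^ 2 + norm x ^ 2.
Proof.
intros [_ [E [_ P]]] x; destruct (P x) as [_ Q]; pose proof (is_adjoint_sym A As E) as E'.
change (0 <= Re (inner ((As (As (A (A x))) [-] RtoC 2 [*] As (A x)) [+] x) x)) in Q.
rewrite inner_plus_l, inner_minus_l, inner_scal_l, !E', !inner_norm in Q.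
unfold Re in Q; simpl in Q; simpl; lra.
Qed.

(** The defect [norm x ^ 2 - norm (A x) ^ 2] of a 2 hyper-contraction does not
    increase under [A], so its zero set is invariant. *)
Lemma hyper_contraction_fixed {H : HilbertSpace} (A As : H -> H) (x : H) :
  two_hyper_contraction A As -> As (A x) = x -> As (A (A x)) = A x.
Proof.
intros HA Ex; pose proof (hyper_contraction A As HA) as Hc.
pose proof (hyper_contraction_convex A As HA x) as P.
destruct HA as [_ [E _]]; apply contraction_norm_eq; [exact E|exact Hc|].
assert (N : norm (A x) ^ 2 = norm x ^ 2).
{ rewrite !norm_sqr, E, Ex; reflexivity. }
specialize (Hc (A x)); pose proof (norm_ge_0 (A (A x))); pose proof (norm_ge_0 (A x)).
nra.
Qed.

Lemma hyper_contraction_fixed_iter {H : HilbertSpace} (A As : H -> H) (x : H) n :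
  two_hyper_contraction A As -> As (A x) = x ->
  As (A (Nat.iter n A x)) = Nat.iter n A x.
Proof.
intros HA Ex; induction n as [|n IH]; [exact Ex|].
simpl; apply hyper_contraction_fixed; assumption.
Qed.

(** With [s = 1 - |z|^2] and [g = s u + conj z x] the hypothesis [norm u = 1 / s]
    says exactly that the contraction [T] preserves the norm of [g].  Hence
    [A (T g) = g], and [x] is a combination of [T g] and [A (T g)]. *)
Lemma extremal_jet_fixed {H : HilbertSpace} (T A : H -> H) (z : C) (x u : H) :
  is_linear T -> two_hyper_contraction A T -> unit_disc z ->
  norm x = 1 -> T x = z [*] x -> inner u x = RtoC 0 -> T u = z [*] u [+] x ->
  norm u ^ 2 = / (1 - Cmod z ^ 2) ^ 2 ->
  T (A x) = x.
Proof.
intros HT HA Hz Nx Ex Oux Eu Nu.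
assert (HAl := proj1 HA); assert (E := proj1 (proj2 HA)).
assert (Hs : 0 < 1 - Cmod z ^ 2).
{ unfold unit_disc in Hz; pose proof (Cmod_ge_0 z); nra. }
set (s := 1 - Cmod z ^ 2) in *.
set (g := RtoC s [*] u [+] Cconj z [*] x).
assert (Tg : T g = Cmult (RtoC s) z [*] u [+] x).
{ unfold g; rewrite (linear_map_plus T HT), !(linear_map_scal T HT), Eu, Ex.
  replace (RtoC s) with (Cminus (RtoC 1) (Cmult z (Cconj z)))
    by (rewrite <- Cmod2_conj; unfold s; rewrite RtoC_minus; reflexivity).
  vector. }
assert (Nz : forall a : C, Cmod (Cmult (RtoC s) a) ^ 2 * norm u ^ 2 = Cmod a ^ 2).
{ intro a; rewrite Cmod_mult, Cmod_R, Rabs_pos_eq, Nu by lra; field; lra. }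
assert (Ng : norm (T g) = norm g).
{ assert (Q : norm (T g) ^ 2 = norm g ^ 2).
  { rewrite Tg; unfold g; rewrite !norm_sqr_plus, !inner_scal_l, !inner_scal_r, Oux.
    rewrite !norm_scal_eq, !Rpow_mult_distr, Nz, Nx, Cmod_conj, Cmod_R, Rabs_pos_eq, Nu by lra.
    unfold Re; simpl; field; lra. }
  pose proof (norm_ge_0 g); pose proof (norm_ge_0 (T g)); nra. }
assert (Eg : A (T g) = g).
{ apply contraction_norm_eq; [apply is_adjoint_sym, E| |exact Ng].
  apply (adjoint_contraction A T E), (hyper_contraction A T HA). }
assert (Cs : RtoC s <> RtoC 0) by (intro F; apply RtoC_inj in F; lra).
(* The [u] terms cancel and the coefficient of [x] is [1 - z * Cconj z = s]. *)
assert (Ek : x = Cinv (RtoC s) [*] (T g [-] z [*] g)).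
{ rewrite Tg; unfold g.
  replace (Cmult (RtoC s) z [*] u [+] x [-] z [*] (RtoC s [*] u [+] Cconj z [*] x))
    with (RtoC s [*] x).
  - vector; field; exact Cs.
  - replace (RtoC s) with (Cminus (RtoC 1) (Cmult z (Cconj z)))
      by (rewrite <- Cmod2_conj; unfold s; rewrite RtoC_minus; reflexivity).
    vector. }
(* So [T g] lies in the fixed set of [T A]; by invariance so does [A (T g) = g], and with them
   [x]. *)
assert (Fk : T (A (T g)) = T g) by (rewrite Eg; reflexivity).
pose proof (hyper_contraction_fixed A T _ HA Fk) as Fg; rewrite Eg in Fg.
rewrite Ek at 1.
rewrite (linear_map_scal A HAl), (linear_map_minus A HAl), (linear_map_scal A HAl).
rewrite (linear_map_scal T HT), (linear_map_minus T HT), (linear_map_scal T HT).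
rewrite Fk, Fg; symmetry; exact Ek.
Qed.

Lemma extremal_kernel_vector {H : HilbertSpace} (T A : H -> H) (z : C) (x : H) :
  is_linear T -> two_hyper_contraction A T -> unit_disc z ->
  norm x = 1 -> T x = z [*] x -> T (A x) = x ->
  exists e, norm e = 1 /\ T e = [0] /\ T (A e) = e.
Proof.
intros HT HA Hz Nx Ex Fx; assert (HAl := proj1 HA).
set (e := x [-] z [*] A x).
(* If [e] vanished, the unit vector [x = z [*] A x] would have norm at most [Cmod z < 1]. *)
assert (Ne : norm e <> 0).
{ intro N; apply norm_eq_0 in N.
  assert (E : x = z [*] A x).
  { replace x with (e [+] z [*] A x) at 1 by (unfold e; vector); rewrite N; vector. }
  apply (f_equal norm) in E; rewrite norm_scal_eq, Nx in E.
  pose proof (hyper_contraction A T HA x) as P; rewrite Nx in P.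
  unfold unit_disc in Hz; pose proof (Cmod_ge_0 z); pose proof (norm_ge_0 (A x)); nra. }
pose proof (norm_ge_0 e).
exists (Cinv (RtoC (norm e)) [*] e); split; [|split].
- rewrite norm_scal_eq, Cmod_inv, Cmod_R, Rabs_pos_eq; [field; exact Ne|lra|].
  intro F; apply RtoC_inj in F; lra.
- rewrite (linear_map_scal T HT); unfold e at 2.
  rewrite (linear_map_minus T HT), (linear_map_scal T HT), Fx, Ex; vector.
- rewrite (linear_map_scal A HAl), (linear_map_scal T HT); f_equal; unfold e.
  rewrite (linear_map_minus A HAl), (linear_map_minus T HT), (linear_map_scal A HAl),
    (linear_map_scal T HT), Fx, (hyper_contraction_fixed A T x HA Fx); reflexivity.
Qed.

(** * Orthonormal bases and the shift *)

Definition orthonormal {H : HilbertSpace} (e : nat -> H) : Prop :=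
  (forall n, norm (e n) = 1) /\ forall m n, m <> n -> inner (e m) (e n) = RtoC 0.

Definition fourier {H : HilbertSpace} (e : nat -> H) (y : H) (n : nat) : C := inner y (e n).

(** Both ends of the index range vary, so that the same sums serve as partial sums and as Cauchy
    blocks. *)
Definition combination {H : HilbertSpace} (e : nat -> H) (c : nat -> C) (n m : nat) : H :=
  sum_n_m (fun k => c k [*] e k) n m.

Lemma combination_S {H : HilbertSpace} (e : nat -> H) (c : nat -> C) n m : (n <= S m)%nat ->
  combination e c n (S m) = combination e c n m [+] c (S m) [*] e (S m).
Proof. intro L; exact (sum_n_Sm _ n m L). Qed.

Lemma combination_n {H : HilbertSpace} (e : nat -> H) (c : nat -> C) n :
  combination e c n n = c n [*] e n.
Proof. exact (sum_n_n _ n). Qed.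

Lemma combination_empty {H : HilbertSpace} (e : nat -> H) (c : nat -> C) n m : (m < n)%nat ->
  combination e c n m = [0].
Proof. intro L; exact (sum_n_m_zero _ n m L). Qed.

Lemma combination_plus {H : HilbertSpace} (e : nat -> H) (c d : nat -> C) n :
  combination e (fun k => Cplus (c k) (d k)) 0 n = combination e c 0 n [+] combination e d 0 n.
Proof.
induction n as [|n IH]; [rewrite !combination_n; vector|].
rewrite !combination_S, IH by lia; vector.
Qed.

Lemma combination_scal {H : HilbertSpace} (e : nat -> H) (a : C) (c : nat -> C) n :
  combination e (fun k => Cmult a (c k)) 0 n = a [*] combination e c 0 n.
Proof.
induction n as [|n IH]; [rewrite !combination_n; vector|].
rewrite !combination_S, IH by lia; vector.
Qed.

Lemma combination_ext {H : HilbertSpace} (e : nat -> H) (c d : nat -> C) n m :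
  (forall k, c k = d k) -> combination e c n m = combination e d n m.
Proof. intro E; apply sum_n_m_ext; intro k; rewrite E; reflexivity. Qed.

Lemma inner_combination {H : HilbertSpace} (e : nat -> H) (c : nat -> C) n m j :
  orthonormal e ->
  inner (combination e c n m) (e j) =
  if (Nat.leb n j && Nat.leb j m)%bool then c j else RtoC 0.
Proof.
intros [E1 E0].
assert (D : forall k, inner (c k [*] e k) (e j) = if Nat.eqb k j then c j else RtoC 0).
{ intro k; rewrite inner_scal_l; destruct (Nat.eqb_spec k j) as [->|N].
  - rewrite inner_norm, E1, pow1; ring.
  - rewrite E0 by exact N; ring. }
induction m as [|m IH].
- destruct n as [|n].
  + rewrite combination_n, D; destruct j; reflexivity.
  + rewrite combination_empty, inner_zero_l by lia.
    destruct j; simpl; [reflexivity|rewrite Bool.andb_false_r; reflexivity].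
- destruct (Nat.leb_spec n (S m)) as [L|L].
  + rewrite combination_S, inner_plus_l, IH, D by exact L.
    destruct (Nat.eqb_spec (S m) j), (Nat.leb_spec n j), (Nat.leb_spec j m),
      (Nat.leb_spec j (S m)); simpl; try lia; ring.
  + rewrite combination_empty, inner_zero_l by exact L.
    destruct (Nat.leb_spec n j), (Nat.leb_spec j (S m)); simpl; try lia; reflexivity.
Qed.

Lemma norm_combination {H : HilbertSpace} (e : nat -> H) (c : nat -> C) n m :
  orthonormal e ->
  norm (combination e c n m) ^ 2 = sum_n_m (fun k => Cmod (c k) ^ 2) n m.
Proof.
intro He; assert (E1 := proj1 He).
assert (D : forall k, norm (c k [*] e k) ^ 2 = Cmod (c k) ^ 2).
{ intro k; rewrite norm_scal_eq, E1; ring. }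
induction m as [|m IH].
- destruct n as [|n].
  + rewrite combination_n, sum_n_n; apply D.
  + rewrite combination_empty, sum_n_m_zero, norm_0 by lia; unfold zero; simpl; ring.
- destruct (Nat.leb_spec n (S m)) as [L|L].
  + rewrite combination_S, sum_n_Sm by exact L.
    rewrite norm_sqr_plus, IH, D, inner_scal_r, inner_combination by exact He.
    replace (Nat.leb n (S m) && Nat.leb (S m) m)%bool with false
      by (symmetry; apply Bool.andb_false_iff; right; apply Nat.leb_gt; lia).
    unfold plus, Re; simpl; ring.
  + rewrite combination_empty, sum_n_m_zero, norm_0 by exact L; unfold zero; simpl; ring.
Qed.

Lemma norm_fourier_remainder {H : HilbertSpace} (e : nat -> H) (y : H) n :
  orthonormal e ->
  norm (y [-] combination e (fourier e y) 0 n) ^ 2 =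
  norm y ^ 2 - sum_n (fun k => Cmod (fourier e y k) ^ 2) n.
Proof.
intro He; rewrite norm_sqr_minus, norm_combination by exact He.
assert (E : Re (inner y (combination e (fourier e y) 0 n)) =
  sum_n (fun k => Cmod (fourier e y k) ^ 2) n).
{ assert (D : forall k, Re (inner y (fourier e y k [*] e k)) = Cmod (fourier e y k) ^ 2).
  { intro k; rewrite inner_scal_r; fold (fourier e y k).
    rewrite Cmult_comm, <- Cmod2_conj; reflexivity. }
  induction n as [|n IH].
  - rewrite combination_n, sum_O; apply D.
  - rewrite combination_S, sum_Sn, inner_plus_r, <- IH, <- D by lia; reflexivity. }
rewrite E; unfold sum_n; ring.
Qed.

Lemma Bessel {H : HilbertSpace} (e : nat -> H) (y : H) n : orthonormal e ->
  sum_n (fun k => Cmod (fourier e y k) ^ 2) n <= norm y ^ 2.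
Proof.
intro He; pose proof (norm_fourier_remainder e y n He).
pose proof (pow2_ge_0 (norm (y [-] combination e (fourier e y) 0 n))); lra.
Qed.

Lemma fourier_summable {H : HilbertSpace} (e : nat -> H) (y : H) : orthonormal e ->
  ex_series (fun k => Cmod (fourier e y k) ^ 2).
Proof.
intro He; apply ex_series_bounded with (norm y ^ 2).
- intro; apply Cmod2_nonneg.
- intro n; apply Bessel, He.
Qed.

Definition fourier_converges {H : HilbertSpace} (e : nat -> H) (y : H) : Prop :=
  forall eps, 0 < eps -> exists N, forall n, (N <= n)%nat ->
    norm (y [-] combination e (fourier e y) 0 n) < eps.

(** By [norm_combination] the Cauchy criterion for the vector series is that of the scalar series of
    squares, with [eps ^ 2] in place of [eps]. *)
Lemma Riesz_Fischer {H : HilbertSpace} (e : nat -> H) (c : nat -> C) : orthonormal e ->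
  ex_series (fun k => Cmod (c k) ^ 2) ->
  exists y, (forall n, fourier e y n = c n) /\ fourier_converges e y.
Proof.
intros He Hc.
assert (S : ex_series (fun k => c k [*] e k)).
{ apply ex_series_Cauchy; intro eps.
  assert (Heps : 0 < eps ^ 2) by (apply pow_lt, cond_pos).
  destruct (Cauchy_ex_series (V := R_CompleteNormedModule) _ Hc (mkposreal _ Heps)) as [N HN].
  exists N; intros n m Hn Hm; specialize (HN n m Hn Hm); simpl in HN.
  change (norm (combination e c n m) < eps).
  change (Rabs (sum_n_m (fun k => Cmod (c k) ^ 2) n m) < eps ^ 2) in HN.
  rewrite <- (norm_combination e c n m He) in HN.
  apply Rle_lt_trans with (1 := Rle_abs _) in HN.
  apply Rsqr_incrst_0; [unfold Rsqr; simpl in HN; lra|apply norm_ge_0|left; apply cond_pos]. }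
destruct S as [y Hy]; pose proof (proj1 (is_series_norm _ _) Hy) as Ny; clear Hy.
assert (F : forall n, fourier e y n = c n).
{ intro n.
  assert (Z : Cmod (Cminus (fourier e y n) (c n)) = 0).
  { apply Rle_antisym; [|apply Cmod_ge_0].
    apply le_epsilon; intros eps Heps; rewrite Rplus_0_l.
    destruct (Ny eps Heps) as [N HN]; specialize (HN (N + n)%nat ltac:(lia)).
    change (norm (combination e c 0 (N + n) [-] y) < eps) in HN.
    pose proof (Cauchy_Schwarz (combination e c 0 (N + n) [-] y) (e n)) as P.
    rewrite (proj1 He), inner_minus_l, inner_combination in P by exact He.
    rewrite (proj2 (Nat.leb_le n (N + n))) in P by lia; simpl in P.
    rewrite Cmod_sym; unfold fourier; lra. }
  apply Cmod_eq_0 in Z.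
  replace (fourier e y n) with (Cplus (Cminus (fourier e y n) (c n)) (c n)) by ring.
  rewrite Z; ring. }
exists y; split; [exact F|].
intros eps Heps; destruct (Ny eps Heps) as [N HN].
exists N; intros n Hn; rewrite (combination_ext e _ c 0 n F), norm_minus_sym.
exact (HN n Hn).
Qed.

Lemma fourier_converges_zero {H : HilbertSpace} (e : nat -> H) : orthonormal e ->
  fourier_converges e [0].
Proof.
intros He eps Heps; exists O; intros n _.
assert (Q : norm ([0] [-] combination e (fourier e [0]) 0 n) ^ 2 <= 0).
{ rewrite norm_fourier_remainder, norm_0 by exact He.
  pose proof (sum_n_nonneg (fun k => Cmod (fourier e [0] k) ^ 2) n (fun k => Cmod2_nonneg _)).
  lra. }
pose proof (norm_ge_0 ([0] [-] combination e (fourier e [0]) 0 n)); nra.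
Qed.

(** The shape [a [*] x [+] y] is that of [span_add], for the induction over a linear span. *)
Lemma fourier_converges_combine {H : HilbertSpace} (e : nat -> H) (a : C) (x y : H) :
  fourier_converges e x -> fourier_converges e y -> fourier_converges e (a [*] x [+] y).
Proof.
intros Hx Hy eps Heps; pose proof (Cmod_ge_0 a) as Ha.
destruct (Hx (eps / 2 / (Cmod a + 1))) as [N1 HN1]; [apply Rdiv_lt_0_compat; lra|].
destruct (Hy (eps / 2) ltac:(lra)) as [N2 HN2].
exists (N1 + N2)%nat; intros n Hn.
specialize (HN1 n ltac:(lia)); specialize (HN2 n ltac:(lia)).
rewrite (combination_ext e _ (fun k => Cplus (Cmult a (fourier e x k)) (fourier e y k)))
  by (intro k; unfold fourier; expand_inner; reflexivity).
rewrite combination_plus, combination_scal.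
set (p := combination e (fourier e x) 0 n) in *; set (q := combination e (fourier e y) 0 n) in *.
replace (a [*] x [+] y [-] (a [*] p [+] q)) with (a [*] (x [-] p) [+] (y [-] q)) by vector.
apply Rle_lt_trans with (1 := norm_plus_le _ _); rewrite norm_scal_eq.
assert (Cmod a * norm (x [-] p) <= (Cmod a + 1) * (eps / 2 / (Cmod a + 1))).
{ apply Rmult_le_compat; try lra; apply norm_ge_0. }
replace ((Cmod a + 1) * (eps / 2 / (Cmod a + 1))) with (eps / 2) in * by (field; lra); lra.
Qed.

(** The remainder of [d = y [-] x] after subtracting any Fourier sum is at most [norm d], uniformly
    in the length of the sum. *)
Lemma fourier_converges_limit {H : HilbertSpace} (e : nat -> H) (y : H) : orthonormal e ->
  (forall eps, 0 < eps -> exists x, fourier_converges e x /\ norm (y [-] x) < eps) ->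
  fourier_converges e y.
Proof.
intros He Hy eps Heps.
destruct (Hy (eps / 2) ltac:(lra)) as [x [Hx Dx]].
destruct (Hx (eps / 2) ltac:(lra)) as [N HN].
exists N; intros n Hn; specialize (HN n Hn).
set (d := y [-] x).
rewrite (combination_ext e _ (fun k => Cplus (Cmult (RtoC 1) (fourier e d k)) (fourier e x k)))
  by (intro k; unfold fourier, d; expand_inner; ring).
rewrite combination_plus, combination_scal.
set (p := combination e (fourier e x) 0 n) in *.
replace (y [-] (RtoC 1 [*] combination e (fourier e d) 0 n [+] p))
  with ((d [-] combination e (fourier e d) 0 n) [+] (x [-] p)) by (unfold d at 1; vector).
apply Rle_lt_trans with (1 := norm_plus_le _ _).
assert (norm (d [-] combination e (fourier e d) 0 n) <= norm d).
{ apply Rsqr_incr_0_var; [|apply norm_ge_0]; rewrite !Rsqr_pow2, norm_fourier_remainder by exact He.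
  pose proof (sum_n_nonneg (fun k => Cmod (fourier e d k) ^ 2) n (fun k => Cmod2_nonneg _)).
  lra. }
fold d in Dx; lra.
Qed.

Lemma Parseval {H : HilbertSpace} (e : nat -> H) (y : H) : orthonormal e ->
  fourier_converges e y -> Series (fun k => Cmod (fourier e y k) ^ 2) = norm y ^ 2.
Proof.
intros He Hy; apply Rle_antisym.
- apply Series_bounded; [intro; apply Cmod2_nonneg|intro; apply Bessel, He].
- apply le_epsilon; intros eps Heps.
  destruct (Hy (sqrt eps) (sqrt_lt_R0 _ Heps)) as [N HN]; specialize (HN N (Nat.le_refl N)).
  pose proof (norm_fourier_remainder e y N He) as E.
  pose proof (sum_n_le_Series (fun k => Cmod (fourier e y k) ^ 2) N
    (fun k => Cmod2_nonneg _) (fourier_summable e y He)).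
  pose proof (norm_ge_0 (y [-] combination e (fourier e y) 0 N)) as P.
  assert (norm (y [-] combination e (fourier e y) 0 N) ^ 2 <= eps).
  { rewrite <- (pow2_sqrt eps) by lra; apply pow_incr; lra. }
  lra.
Qed.

Lemma isometry_inner {H1 H2 : HilbertSpace} (V : H1 -> H2) : is_linear V ->
  (forall x, norm (V x) = norm x) -> forall x y, inner (V x) (V y) = inner x y.
Proof.
intros HV HN.
assert (R : forall x y, Re (inner (V x) (V y)) = Re (inner x y)).
{ intros x y; pose proof (norm_sqr_plus (V x) (V y)) as P.
  rewrite <- (linear_map_plus V HV), !HN, norm_sqr_plus in P; lra. }
(* Polarization: real parts come from norms, imaginary parts from replacing [y] by [Ci [*] y]. *)
intros x y; pose proof (R x y) as P; pose proof (R x (Ci [*] y)) as Q.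
rewrite (linear_map_scal V HV), !inner_scal_r in Q.
destruct (inner (V x) (V y)) as [a b], (inner x y) as [a' b'].
unfold Re in *; simpl in *; f_equal; lra.
Qed.

Lemma orthonormal_basis_unitary {H : HilbertSpace} (e : nat -> H) : orthonormal e ->
  (forall y, fourier_converges e y) ->
  exists V : H -> l2_Hilbert, is_unitary V /\ forall y n, l2_seq (V y) n = inner y (e n).
Proof.
intros He Hy.
pose (V := (fun y => mk_l2 (fourier e y) (fourier_summable e y He)) : H -> l2_Hilbert).
assert (HN : forall y, norm (V y) = norm y).
{ intro y; change (sqrt (Series (fun k => Cmod (fourier e y k) ^ 2)) = norm y).
  rewrite Parseval by auto.
  apply sqrt_pow2, norm_ge_0. }
assert (HV : is_linear V).
{ split.
  - intros x y; apply l2_ext; intro n; exact (inner_plus_l H x y (e n)).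
  - intros c x; apply l2_ext; intro n; exact (inner_scal_l H c x (e n)).
  - exists 1; split; [lra|]; intro x; rewrite HN; lra. }
exists V; split; [split; [exact HV|split]|reflexivity].
- apply isometry_inner; assumption.
- intro c; destruct (Riesz_Fischer e c He (l2_summable c)) as [y [F _]].
  exists y; apply l2_ext; exact F.
Qed.

(** * The orbit of the kernel vector and the backward shift *)

(** On the orbit [T A] is the identity, so a common power of [A] can be stripped from both slots of
    an inner product; what remains of a mixed one ends in [T e = [0]]. *)
Lemma orthonormal_iterates {H : HilbertSpace} (T A : H -> H) (e : H) : is_linear T ->
  is_adjoint A T -> norm e = 1 -> T e = [0] ->
  (forall n, T (A (Nat.iter n A e)) = Nat.iter n A e) ->
  orthonormal (fun n => Nat.iter n A e).
Proof.
intros HT HA Ne Te Hit.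
assert (L : forall m n, inner (Nat.iter (S (m + n)) A e) (Nat.iter n A e) = RtoC 0).
{ intros m n; induction n as [|n IH].
  - rewrite Nat.add_0_r; change (inner (A (Nat.iter m A e)) e = RtoC 0).
    rewrite HA, Te; apply inner_zero_r.
  - rewrite Nat.add_succ_r.
    change (inner (A (Nat.iter (S (m + n)) A e)) (A (Nat.iter n A e)) = RtoC 0).
    rewrite HA, Hit; exact IH. }
split.
- intro n; assert (Q : norm (Nat.iter n A e) ^ 2 = 1).
  { induction n as [|n IH]; [simpl; rewrite Ne; ring|].
    change (norm (A (Nat.iter n A e)) ^ 2 = 1).
    rewrite norm_sqr, HA, Hit, <- norm_sqr; exact IH. }
  pose proof (norm_ge_0 (Nat.iter n A e)); nra.
- intros m n Hmn; destruct (Nat.lt_total m n) as [Q|[Q|Q]]; [|lia|].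
  + replace n with (S ((n - S m) + m)) by lia.
    rewrite inner_conj, L; unfold Cconj, RtoC; simpl; f_equal; ring.
  + replace m with (S ((m - S n) + n)) by lia; apply L.
Qed.

(** The vector [v] with coefficients [w^k] is square summable since [Cmod w < 1], and shifting it
    backwards multiplies it by [w]. The eigenspace being one-dimensional, [x] is a multiple of
    [v]. *)
Lemma eigenvector_fourier_converges {H : HilbertSpace} (T : H -> H) (e : nat -> H) (w : C) (x : H) :
  is_linear T -> one_dimensional (eigenspace T w) -> unit_disc w -> eigenspace T w x ->
  orthonormal e -> T (e O) = [0] -> (forall n, T (e (S n)) = e n) ->
  fourier_converges e x.
Proof.
intros HT [b [_ Hb]] Hw Ex He T0 TS.
assert (Sw : ex_series (fun k => Cmod (Cpow w k) ^ 2)).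
{ apply ex_series_ext with (fun k => (Cmod w ^ 2) ^ k).
  - intro k; rewrite Cmod_pow, <- !pow_mult, Nat.mul_comm; reflexivity.
  - apply ex_series_geom; rewrite Rabs_pos_eq by apply pow2_ge_0.
    unfold unit_disc in Hw; pose proof (Cmod_ge_0 w); nra. }
destruct (Riesz_Fischer e (Cpow w) He Sw) as [v [Fv Cv]].
(* [T] kills the first term, so the sum loses one term; hence the two tails [Q1] and [Q2] below. *)
assert (TC : forall n, T (combination e (Cpow w) 0 (S n)) = w [*] combination e (Cpow w) 0 n).
{ induction n as [|n IH].
  - rewrite combination_S, !combination_n, (linear_map_plus T HT), !(linear_map_scal T HT),
      T0, TS by lia; simpl; vector.
  - rewrite combination_S, (linear_map_plus T HT), (linear_map_scal T HT), IH, TS by lia.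
    rewrite (combination_S e (Cpow w) 0 n) by lia; simpl; vector. }
assert (Ev : T v = w [*] v).
{ assert (N : norm (T v [-] w [*] v) = 0).
  { apply Rle_antisym; [|apply norm_ge_0].
    apply le_epsilon; intros eps Heps; rewrite Rplus_0_l.
    destruct (linear_norm T HT) as [M [HM HMn]].
    destruct (Cv (eps / (M + 1))) as [N HN]; [apply Rdiv_lt_0_compat; lra|].
    pose proof (HN N (Nat.le_refl N)) as Q1; pose proof (HN (S N) ltac:(lia)) as Q2.
    rewrite (combination_ext e _ (Cpow w) 0 _ Fv) in Q1.
    rewrite (combination_ext e _ (Cpow w) 0 _ Fv) in Q2.
    specialize (HMn (v [-] combination e (Cpow w) 0 (S N))).
    rewrite (linear_map_minus T HT), TC in HMn.
    set (p := combination e (Cpow w) 0 N) in *.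
    pose proof (norm_plus_le (T v [-] w [*] p) (Copp w [*] (v [-] p))) as P.
    replace (T v [-] w [*] p [+] Copp w [*] (v [-] p)) with (T v [-] w [*] v) in P by vector.
    rewrite norm_scal_eq, Cmod_opp in P.
    unfold unit_disc in Hw; pose proof (Cmod_ge_0 w); pose proof (norm_ge_0 (v [-] p)).
    assert (Cmod w * norm (v [-] p) <= 1 * norm (v [-] p)) by (apply Rmult_le_compat_r; lra).
    apply (Rmult_lt_compat_l M) in Q2; [|exact HM].
    replace eps with (M * (eps / (M + 1)) + eps / (M + 1)) by (field; lra); lra. }
  apply norm_eq_0 in N.
  replace (T v) with ((T v [-] w [*] v) [+] w [*] v) by vector; rewrite N; vector. }
destruct (proj1 (Hb v) Ev) as [c Hc]; destruct (proj1 (Hb x) Ex) as [d Hd].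
change (v = c [*] b) in Hc; change (x = d [*] b) in Hd.
(* The zeroth coefficient of [v] is [w^0 = 1], so [v] is not zero. *)
assert (Hc0 : c <> RtoC 0).
{ intro Z; specialize (Fv O); unfold fourier in Fv.
  rewrite Hc, inner_scal_l, Z in Fv; simpl in Fv.
  apply (f_equal Re) in Fv; unfold Re in Fv; simpl in Fv; lra. }
replace x with (Cdiv d c [*] v [+] [0])
  by (rewrite Hd, Hc; vector; field; exact Hc0).
apply fourier_converges_combine; [exact Cv|apply fourier_converges_zero, He].
Qed.

Lemma unitarily_equivalent_backward_shift {H : HilbertSpace} (T A : H -> H) (e : H) :
  cowen_douglas_B1 T -> is_adjoint A T -> norm e = 1 -> T e = [0] ->
  (forall n, T (A (Nat.iter n A e)) = Nat.iter n A e) ->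
  unitarily_equivalent T backward_shift.
Proof.
intros HB HA Ne Te Hit; pose proof (B1_bounded T HB) as HT.
pose proof (orthonormal_iterates T A e HT HA Ne Te Hit) as He.
set (f := fun n => Nat.iter n A e) in *.
assert (Hspan : forall y, linear_span
    (fun x => exists w, unit_disc w /\ eigenspace T w x) y -> fourier_converges f y).
{ intros y Hy; induction Hy as [|c x y [w [Hw Ex]] _ IH].
  - apply fourier_converges_zero, He.
  - apply (fourier_converges_combine f c x y); [|exact IH].
    apply (eigenvector_fourier_converges T f w x); try assumption.
    apply (B1_kernel T HB w Hw). }
destruct (orthonormal_basis_unitary f He) as [V [HV Vn]].
{ intro y; apply fourier_converges_limit; [exact He|]; intros eps Heps.
  destruct (B1_span T HB y (mkposreal eps Heps)) as [x [Hx Dx]].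
  exists x; split; [apply Hspan, Hx|exact Dx]. }
exists V; split; [exact HV|]; intro y; apply l2_ext; intro n.
change (l2_seq (V (T y)) n = l2_seq (V y) (S n)).
(* Moving [T] across the inner product turns [A^n e] into [A^(n+1) e], the next coefficient. *)
rewrite !Vn, (is_adjoint_sym A T HA); reflexivity.
Qed.

Theorem theorem3p8 (H : HilbertSpace) (H_separable : separable H)
  (T Tstar : H -> H)
  (T_B1 : cowen_douglas_B1 T)
  (T_adjoint : is_adjoint T Tstar)
  (Tstar_hyper : two_hyper_contraction Tstar T)
  (polys_dense : forall (phi : C -> C) (P : H -> H),
     disc_automorphism phi -> is_functional_calculus phi T P ->
     forall (U : C -> Prop) (G : RKHS U), is_H0 P U G -> polynomials_dense G)
  (zeta : C) (zeta_disc : unit_disc zeta)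
  (curvature_zeta : has_curvature T zeta (RtoC (- / (1 - Cmod zeta ^ 2) ^ 2))) :
  unitarily_equivalent T backward_shift.
Proof.
destruct (curvature_jet T zeta _ T_B1 zeta_disc curvature_zeta) as [x [u [Nx [Ex [Oux [Eu Ek]]]]]].
assert (Nu : norm u ^ 2 = / (1 - Cmod zeta ^ 2) ^ 2).
{ rewrite <- RtoC_opp in Ek; apply RtoC_inj in Ek; lra. }
pose proof (B1_bounded T T_B1) as HT.
pose proof (extremal_jet_fixed T Tstar zeta x u HT Tstar_hyper zeta_disc Nx Ex Oux Eu Nu) as Fx.
destruct (extremal_kernel_vector T Tstar zeta x HT Tstar_hyper zeta_disc Nx Ex Fx)
  as [e [Ne [Te Fe]]].
apply (unitarily_equivalent_backward_shift T Tstar e T_B1); try assumption.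
- exact (is_adjoint_sym T Tstar T_adjoint).
- intro n; apply hyper_contraction_fixed_iter; assumption.
Qed.
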